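(* Let $L$ be a field of characteristic $0$, and let $L((T^{-1}))$ have the usual addition, the standard degree map $\deg$ and the topology it induces. Let $\delta_i : L \to L$, $i \in \mathbb{Z}_{\le 0}$, be additive maps, not all zero. Then the following are equivalent. (1) There exists a unique multiplication $\tilde\delta$ on $L((T^{-1}))$ such that $L((T^{-1};\tilde\delta))$ is a deformed Laurent series ring with the standard degree map, satisfying $$T\cdot a = aT + \sum_{i=0}^{-\infty} \delta_i(a) T^i, \qquad a \in L.$$ (2) For all $i \in \mathbb{Z}_{\le 0}$ and all $a,b \in L$, $$\delta_i(ab) = a\,\delta_i(b) + \delta_i(a)\, b + \sum_{k>0}\ \sum_{\substack{l, j_1,\dots,j_k \in \mathbb{Z}_{\le 0}\\ j_1+\cdots+j_k-k+l=i}} \binom{l}{k}\, \delta_l(a)\, \delta_{j_1}\cdots\delta_{j_k}(b).$$ If (1) or (2) holds, then the multiplication $\tilde\delta$ is given by $$\Big(\sum_{i\le m} a_iT^i\Big)\Big(\sum_{j\le n} b_jT^j\Big) = \sum_{i\le m,\, j\le n} a_iT^i\cdot b_jT^j,$$ where $$a_iT^i\cdot b_jT^j = a_ib_jT^{i+j} + \sum_{k\ge 1}\ \sum_{(j_1,\dots,j_k)\in(\mathbb{Z}_{\le 0})^k} \binom{i}{k}\, a_i\, \delta_{j_1}\cdots\delta_{j_k}(b_j)\, T^{j_1+\cdots+j_k-k+i+j}.$$ Moreover, $L((T^{-1};\tilde\delta))$ is then a topological division ring which is complete with respect to the topology induced by the standard degree map, and its center is the field $K=\bigcap_{i\le 0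}\mathrm{Ker}(\delta_i)$.
   Context: For a field $L$, $L((T^{-1}))=\{\sum_{i\le k} a_iT^i : a_i\in L,\ k\in\mathbb{Z}\}$ is the left $L$-vector space of (inverse) formal Laurent series (its usual multiplication is disregarded). The standard degree map is $\deg: L((T^{-1}))\to \mathbb{Z}\cup\{-\infty\}$, $\deg 0=-\infty$, $\deg(\sum_{i\le k}a_iT^i)=k$ if $a_k\neq 0$. The topology is induced by the metric $d(f,g)=e^{\deg(f-g)}$. A deformed Laurent series ring (with the standard degree map) $L((T^{-1};\tilde\delta))$ is $L((T^{-1}))$ with its usual addition, standard degree map and topology, together with a multiplication $\tilde\delta:(f,g)\mapsto f\cdot g$ such that: (i) the multiplication is associative, distributive over addition, and continuous; (ii) $b\cdot \sum_{i\le k}a_iT^i=\sum_{i\le k}(ba_i)T^i$ for $b\in L$; (iii) $T^i\cdot T^j=T^{i+j}$ for $i,j\in\mathbb{Z}$ (with $T^0=1$); (iv) $\deg(f\cdot g)=\deg f+\deg g$ for all $f,g$. For an integer $a$ and $k\ge 0$, $\binom{a}{k}=a(a-1)\cdots(a-k+1)/k!$, with $\binom a0=1$. The notation $\delta_{j_1}\cdots\delta_{j_k}$ means composition of maps. *)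

(* Defs.v *)
From HB Require Import structures.
From mathcomp Require Import all_boot all_order all_algebra.
From mathcomp Require Import all_classical all_reals all_analysis.
From mathcomp Require Import summability Rstruct.

Set Implicit Arguments.
Unset Strict Implicit.
Unset Printing Implicit Defensive.

Import Order.TTheory GRing.Theory Num.Theory.
Local Open Scope classical_set_scope.
Local Open Scope ring_scope.

Section LaurentSeries.
Variable L : fieldType.

(* A family of coefficients (a_i) stands for the inverse formal Laurent series
   \sum_(i <= k) a_i T^i exactly when it vanishes above some exponent k. *)
Definition laurent_coef : pred (int -> L) :=
  fun a => `[< exists k : int, forall i, k < i -> a i = 0 >].

Record laurent := Laurent { lcoef :> int -> L; _ : laurent_coef lcoef }.

HB.instance Definition _ := [isSub for lcoef].
HB.instance Definition _ := [Choice of laurent by <:].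

Lemma laurentP (f : laurent) : exists k : int, forall i, k < i -> f i = 0.
Proof. by have /asboolP := valP f. Qed.

Lemma laurent_eqP (f g : laurent) : (forall i, f i = g i) -> f = g.
Proof. by move=> fg; apply: val_inj; apply/funext. Qed.

Fact laurent_zmod_closed : zmod_closed laurent_coef.
Proof.
split; first by apply/asboolP; exists 0.
move=> a b /asboolP[k ak] /asboolP[l bl]; apply/asboolP; exists (Num.max k l).
move=> i; rewrite gt_max => /andP[ki li].
by rewrite !fctE ak// bl// subr0.
Qed.
HB.instance Definition _ :=
  GRing.isZmodClosed.Build (int -> L) laurent_coef laurent_zmod_closed.
HB.instance Definition _ := [SubChoice_isSubZmodule of laurent by <:].

Lemma coef0 i : (0 : laurent) i = 0. Proof. by []. Qed.
Lemma coefN (f : laurent) i : (- f) i = - f i. Proof. by []. Qed.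
Lemma coefD (f g : laurent) i : (f + g) i = f i + g i. Proof. by []. Qed.
Lemma coefB (f g : laurent) i : (f - g) i = f i - g i. Proof. by []. Qed.

Fact laurent_scale_subproof (b : L) (f : laurent) :
  laurent_coef (fun i => b * f i).
Proof.
by have [k fk] := laurentP f; apply/asboolP; exists k => i /fk ->; rewrite mulr0.
Qed.
Definition laurent_scale b f := Laurent (laurent_scale_subproof b f).

Lemma laurent_scaleE b f i : laurent_scale b f i = b * f i. Proof. by []. Qed.

Fact laurent_scaleA a b f :
  laurent_scale a (laurent_scale b f) = laurent_scale (a * b) f.
Proof. by apply: laurent_eqP => i /=; rewrite mulrA. Qed.
Fact laurent_scale1 : left_id 1 laurent_scale.
Proof. by move=> f; apply: laurent_eqP => i /=; rewrite mul1r. Qed.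
Fact laurent_scaleDr : right_distributive laurent_scale +%R.
Proof. by move=> a f g; apply: laurent_eqP => i; rewrite coefD !laurent_scaleE coefD mulrDr. Qed.
Fact laurent_scaleDl f : {morph laurent_scale^~ f : a b / a + b}.
Proof. by move=> a b; apply: laurent_eqP => i; rewrite coefD !laurent_scaleE mulrDl. Qed.
HB.instance Definition _ := GRing.Zmodule_isLmodule.Build L laurent
  laurent_scaleA laurent_scale1 laurent_scaleDr laurent_scaleDl.

Fact mono_subproof (n : int) (a : L) :
  laurent_coef (fun i => if i == n then a else 0).
Proof. by apply/asboolP; exists n => i /gt_eqF ->. Qed.
(* [mono n a] is the series a T^n; in particular [mono 0 a] is a viewed in
   L((T^-1)). *)
Definition mono n a := Laurent (mono_subproof n a).

Fact nonpos_subproof (a : nat -> L) :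
  laurent_coef (fun i => if i <= 0 then a `|i|%N else 0).
Proof. by apply/asboolP; exists 0 => i /lt_geF ->. Qed.
(* \sum_(i <= 0) a_i T^i, where [a n] is the coefficient a_(-n). *)
Definition nonpos_series a := Laurent (nonpos_subproof a).

Definition deg (f : laurent) : \bar int :=
  if f == 0 then -oo%E
  else (xget 0 [set k | f k != 0 /\ forall i, k < i -> f i = 0])%:E.

Lemma deg0 : deg 0 = -oo%E. Proof. by rewrite /deg eqxx. Qed.

Lemma degP (f : laurent) : f != 0 ->
  exists k, [/\ deg f = k%:E, f k != 0 & forall i, k < i -> f i = 0].
Proof.
move=> f0; have [k fk] := laurentP f.
have ex : exists n : nat, f (k - n%:Z) != 0.
  apply: contrapT => /forallNP nf; move/eqP: f0; apply; apply: laurent_eqP => i.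
  have [/fk //|ik] := ltP k i.
  have := nf `|k - i|%N; rewrite gez0_abs ?subr_ge0// opprB addrC subrK.
  by move/negP/negPn/eqP.
suff : [set k | f k != 0 /\ forall i, k < i -> f i = 0] !=set0.
  move=> [l Pl]; exists (xget 0 [set k | f k != 0 /\ forall i, k < i -> f i = 0]).
  by rewrite /deg (negPf f0); case: xgetP => [_ -> []//|/(_ l)].
case: (ex_minnP ex) => m fm mmin; exists (k - m%:Z); split=> // i kmi.
have [/fk //|ik] := ltP k i; apply/eqP/negPn/negP => fi.
have e : k - `|k - i|%N%:Z = i.
  by rewrite gez0_abs ?subr_ge0// opprB addrC subrK.
have := mmin `|k - i|%N; rewrite e => /(_ fi).
by rewrite -lez_nat gez0_abs ?subr_ge0// lerBrDr -lerBrDl leNgt kmi.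
Qed.

(* e^(deg f), with e^(-oo) = 0. *)
Definition exp_deg (f : laurent) : Rdefinitions.R :=
  if deg f is k%:E then expR (k%:~R) else 0.

Definition ldist (f g : laurent) : Rdefinitions.R := exp_deg (f - g).

Lemma exp_deg_ge0 f : 0 <= exp_deg f.
Proof. by rewrite /exp_deg; case: deg => // k; exact: expR_ge0. Qed.

Lemma exp_deg_le (f : laurent) (k : int) :
  (forall i, k < i -> f i = 0) -> exp_deg f <= expR (k%:~R).
Proof.
move=> fk; have [->|f0] := eqVneq f 0.
  by rewrite /exp_deg deg0 expR_ge0.
have [l [fl fl0 _]] := degP f0; rewrite /exp_deg fl ler_expR ler_int leNgt.
by apply: contra fl0 => /fk ->.
Qed.

Fact ldistxx f : ldist f f = 0.
Proof. by rewrite /ldist subrr /exp_deg deg0. Qed.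

Fact ldist_positivity f g : ldist f g = 0 -> f = g.
Proof.
have [/eqP|fg] := eqVneq (f - g) 0; first by rewrite subr_eq0 => /eqP.
have [k [fk _ _]] := degP fg; rewrite /ldist /exp_deg fk => /eqP.
by rewrite gt_eqF ?expR_gt0.
Qed.

Fact exp_deg_opp_le f : exp_deg (- f) <= exp_deg f.
Proof.
have [->|f0] := eqVneq f 0; first by rewrite oppr0.
have [k [fk _ fz]] := degP f0; rewrite {2}/exp_deg fk; apply: exp_deg_le => i ki.
by rewrite coefN fz// oppr0.
Qed.

Fact ldist_sym f g : ldist f g = ldist g f.
Proof.
apply/le_anti/andP; rewrite /ldist; split.
  by rewrite -(opprB g f) exp_deg_opp_le.
by rewrite -(opprB f g) exp_deg_opp_le.
Qed.

Fact ldist_triangle g f h : ldist f h <= ldist f g + ldist g h.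
Proof.
rewrite /ldist; have -> : f - h = (f - g) + (g - h) by rewrite addrA subrK.
have [->|u0] := eqVneq (f - g) 0; first by rewrite add0r lerDr exp_deg_ge0.
have [->|v0] := eqVneq (g - h) 0; first by rewrite addr0 lerDl exp_deg_ge0.
have [k [uk _ uz]] := degP u0; have [l [vl _ vz]] := degP v0.
apply: (@le_trans _ _ (expR ((Num.max k l)%:~R))).
  apply: exp_deg_le => i; rewrite gt_max => /andP[ki li].
  by rewrite coefD uz// vz// addr0.
rewrite /exp_deg uk vl.
by case: (leP k l) => _; rewrite ?lerDl ?lerDr expR_ge0.
Qed.

HB.instance Definition _ := isMetric.Build Rdefinitions.R laurent
  ldistxx ldist_positivity ldist_sym ldist_triangle.

Record deformed_laurent_ring (mul : laurent -> laurent -> laurent) : Prop := {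
  dl_mulA : associative mul;
  dl_mulDl : left_distributive mul +%R;
  dl_mulDr : right_distributive mul +%R;
  dl_mul_continuous :
    continuous (fun p : laurent * laurent => mul p.1 p.2);
  dl_scale : forall (b : L) (f : laurent), mul (mono 0 b) f = b *: f;
  dl_expT : forall i j : int, mul (mono i 1) (mono j 1) = mono (i + j) 1;
  dl_deg : forall f g : laurent, deg (mul f g) = (deg f + deg g)%E }.

Definition binz (a : int) (k : nat) : L :=
  (\prod_(r < k) (a%:~R - r%:R)) / k`!%:R.

Section Delta.
(* Throughout, [delta n] is the map \delta_(-n): the index set Z_(<= 0) is
   encoded by n |-> -n. *)
Variable delta : nat -> {additive L -> L}.

(* \delta_(j_1) ... \delta_(j_k) (b) *)
Definition delta_comp (js : seq nat) (b : L) : L :=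
  foldr (fun j x => delta j x) b js.

Definition delta_rule (mul : laurent -> laurent -> laurent) : Prop :=
  forall a : L,
    mul (mono 1 1) (mono 0 a) = mono 1 a + nonpos_series (fun n => delta n a).

(* With i = -n, l = -m and j_r = -(js_r), the constraint
   j_1 + ... + j_k - k + l = i reads \sum_r js_r + k + m = n; it forces
   k, m and all the js_r to be at most n, so the sum is finite. *)
Definition delta_leibniz : Prop :=
  forall (n : nat) (a b : L),
    delta n (a * b) = a * delta n b + delta n a * b
      + \sum_(1 <= k < n.+1) \sum_(m < n.+1)
          \sum_(js : k.-tuple 'I_n.+1
                | (\sum_(j <- js) (j : nat) + k + m == n)%N)
             binz (- m%:Z) k * delta m a * delta_comp (map val js) b.

Definition delta_ker : pred L := fun a => `[< forall n, delta n a = 0 >].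

(* The term of index (j_1, ..., j_k) in the expansion of a T^i . b T^j. *)
Definition mono_mul_term (i j : int) (a b : L) (js : seq nat) : laurent :=
  mono (i + j - (sumn js + size js)%:Z)
       (binz i (size js) * a * delta_comp js b).

End Delta.
End LaurentSeries.

(* Unconditional convergence: the finite partial sums, directed by inclusion,
   converge. *)
Definition has_sum (I : choiceType) (A : PreTopologicalZmodule.type)
    (F : I -> A) (s : A) : Prop :=
  partial_sum F @ totally --> s.

Definition complete_space (A : uniformType) : Prop :=
  forall F : set_system A, ProperFilter F -> cauchy F -> exists l : A, F --> l.

Record topological_division_ring (A : PreTopologicalZmodule.type)
    (mul : A -> A -> A) (one : A) : Prop := {
  tdr_add_continuous : continuous (fun p : A * A => p.1 + p.2);
  tdr_opp_continuous : continuous (fun x : A => - x);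
  tdr_mul_continuous : continuous (fun p : A * A => mul p.1 p.2);
  tdr_mulA : associative mul;
  tdr_mulDl : left_distributive mul +%R;
  tdr_mulDr : right_distributive mul +%R;
  tdr_mul1l : left_id one mul;
  tdr_mul1r : right_id one mul;
  tdr_one_neq0 : one <> 0;
  tdr_inv : exists2 inv : A -> A,
    forall x, x <> 0 -> mul (inv x) x = one /\ mul x (inv x) = one
    & {within [set x | x <> 0], continuous inv} }.

Definition ring_center (A : Type) (mul : A -> A -> A) : set A :=
  [set z | forall x, mul z x = mul x z].

(* Main.v *)
(* Left multiplication by T must be the operator U = S + Delta, where S is the
   shift a T^j |-> a T^(j+1) and Delta (\sum_j a_j T^j) is the sum of the
   delta_l(a_j) T^(j+l).  Since Delta commutes with S and does not raise degrees,
   S^-1 Delta lowers degrees, so U is invertible and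
   U^i = S^i \sum_k binom(i, k) (S^-1 Delta)^k for every integer i; as additive
   operators that respect the degree filtration are determined by their values
   on monomials, the multiplication can only be
   (\sum_i f_i T^i) g = \sum_i f_i U^i(g).
   Conversely this formula always defines a continuous product with additive
   degree, and it is associative as soon as T (b c) = (T b) c for constants b, c;
   comparing coefficients, this is the generalized Leibniz rule (2).
   Inverses are geometric series.  If z of degree k commutes with L and delta_m is
   the first nonzero map, the coefficient of T^(k-1-m) in z a - a z forces k = 0;
   applied to z and to z - z_0 this shows that z is a constant, and a constant
   commutes with T exactly when all the delta_i kill it. *)
Require Import Defs.
From HB Require Import structures.
From mathcomp Require Import all_boot all_order all_algebra.
From mathcomp Require Import all_classical all_reals all_analysis.
From mathcomp Require Import summability Rstruct ring zify.

Set Implicit Arguments.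
Unset Strict Implicit.
Unset Printing Implicit Defensive.

Import Order.TTheory GRing.Theory Num.Theory.
Local Open Scope classical_set_scope.
Local Open Scope ring_scope.

(** * Finite sums over supports and compositions of an integer *)

Lemma eq_big_supp (V : nmodType) (I : eqType) (r1 r2 : seq I) (G : I -> V) :
    uniq r1 -> uniq r2 ->
    (forall i, i \notin r1 -> G i = 0) -> (forall i, i \notin r2 -> G i = 0) ->
  \sum_(i <- r1) G i = \sum_(i <- r2) G i.
Proof.
(* An index in only one of the lists lies outside the other, where [G] vanishes; both sums reduce to
   the common indices. *)
move=> u1 u2 G1 G2; rewrite (bigID (fun i => i \in r2)) /=.
rewrite [X in _ + X]big1 ?addr0 => [|i /G2 //].
rewrite [RHS](bigID (fun i => i \in r1)) /= [X in _ + X]big1 ?addr0 => [|i /G1 //].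
rewrite -big_filter -[RHS]big_filter; apply: perm_big; apply: uniq_perm; rewrite ?filter_uniq//.
by move=> i; rewrite !mem_filter andbC.
Qed.

(** The step is an equivalence so that it can also be run downwards. For powers of T, the downward
    direction comes from injectivity of multiplication by T. *)
Lemma int_shift_ind (Q : int -> Prop) :
  Q 0 -> (forall i, Q i <-> Q (i + 1)) -> forall i, Q i.
Proof.
move=> Q0 QS; elim/int_ind => // n; first by move=> /QS; rewrite intS addrC.
move=> H; apply/QS; suff -> : - n.+1%:Z + 1 = - n%:Z by [].
by rewrite intS opprD addrAC addNr add0r.
Qed.

(** Weak compositions: zero parts are allowed, since the indices j_r may be 0. *)
Fixpoint compositions (k s : nat) : seq (seq nat) :=
  if k is k'.+1 then
    [seq n :: js | n <- iota 0 s.+1, js <- compositions k' (s - n)]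
  else if s == 0%N then [:: [::]] else [::].

Lemma compositionsS k s : compositions k.+1 s =
  [seq n :: js | n <- iota 0 s.+1, js <- compositions k (s - n)].
Proof. by []. Qed.

Lemma mem_compositions k s js :
  (js \in compositions k s) = (size js == k) && (sumn js == s).
Proof.
elim: k s js => [|k IH] s js.
  by case: js => [|n js]; case: s.
rewrite compositionsS; apply/idP/idP => [/allpairsPdep[n [js' [nI]]]|].
  rewrite IH => /andP[/eqP sz /eqP sm] -> /=; move: nI; rewrite mem_iota sz eqxx sm.
  by move=> nI; apply/eqP; lia.
case: js => [//|n js] /andP[/eqP[sz] /eqP];
  rewrite [sumn _]/= => sm; apply/flatten_mapP; exists n.
  by rewrite mem_iota; lia.
by apply: map_f; rewrite IH sz eqxx; apply/eqP; lia.
Qed.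

Lemma compositions_uniq k s : uniq (compositions k s).
Proof.
elim: k s => [|k IH] s; first by rewrite /=; case: ifP.
rewrite compositionsS.
apply: allpairs_uniq_dep => [|n _|[x x'] [y y'] _ _ /= [-> ->]] //.
exact: iota_uniq.
Qed.

Lemma sum_tuple_compositions (V : nmodType) (F : seq nat -> V) (n m k : nat) :
  \sum_(js : k.-tuple 'I_n.+1 | (\sum_(j <- js) (j : nat) + k + m == n)%N)
     F (map val js) =
  if (k + m <= n)%N then \sum_(js <- compositions k (n - m - k)) F js else 0.
Proof.
have E (js : k.-tuple 'I_n.+1) : (\sum_(j <- js) (j : nat))%N = sumn (map val js).
  by rewrite sumnE big_map.
case: ifP => kmn; last by rewrite big1// => js; rewrite E; lia.
rewrite -big_filter -(big_map (fun js : k.-tuple 'I_n.+1 => map val js) xpredT F).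
apply: perm_big; apply: uniq_perm; rewrite ?compositions_uniq//.
  rewrite map_inj_uniq ?filter_uniq ?index_enum_uniq// => x y /inj_map xy.
  by apply/val_inj/xy/val_inj.
move=> x; rewrite mem_compositions; apply/mapP/andP => [[js]|[/eqP sz /eqP sm]].
  rewrite mem_filter E => /andP[/eqP jsn _] ->.
  by rewrite size_map size_tuple eqxx; split=> //; apply/eqP; lia.
(* Each part is at most the total, hence at most n, so [inord] loses nothing. *)
have xn j : j \in x -> (j < n.+1)%N.
  move=> jx; suff : (j <= sumn x)%N by lia.
  by rewrite sumnE (big_rem j jx) leq_addr.
have szi : size (map (@inord n) x) == k by rewrite size_map sz.
have xE : map val (Tuple szi) = x.
  by rewrite /= -map_comp -[RHS]map_id; apply/eq_in_map => j /xn jn /=; rewrite inordK.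
exists (Tuple szi); last by rewrite xE.
rewrite mem_filter mem_index_enum E xE sm andbT; apply/eqP; lia.
Qed.

Arguments mono : simpl never.
Arguments nonpos_series : simpl never.

(** * Degree bounds on Laurent series *)

Section Laurent.
Variable L : fieldType.
Implicit Types (f g h : laurent L) (d e t : int) (a b c : L).

(** The bound deg f <= d, phrased on coefficients so that the zero series needs no separate case. *)
Definition vle d f : Prop := forall t, d < t -> f t = 0.

Lemma vle0 d : vle d (0 : laurent L). Proof. by []. Qed.

Lemma vleW d e f : d <= e -> vle d f -> vle e f.
Proof. by move=> de fd t et; apply: fd; lia. Qed.

Lemma vleN d f : vle d f -> vle d (- f).
Proof. by move=> fd t /fd ft; rewrite Defs.coefN ft oppr0. Qed.

Lemma vleD d f g : vle d f -> vle d g -> vle d (f + g).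
Proof. by move=> fd gd t dt; rewrite Defs.coefD fd// gd// addr0. Qed.

Lemma vleB d f g : vle d f -> vle d g -> vle d (f - g).
Proof. by move=> fd /vleN; apply: vleD. Qed.

Lemma vleZ d a f : vle d f -> vle d (a *: f).
Proof. by move=> fd t dt; rewrite [LHS]laurent_scaleE fd// mulr0. Qed.

Lemma lcoefZ a f t : (a *: f) t = a * f t. Proof. by []. Qed.

Lemma vle_sum (I : Type) (r : seq I) (F : I -> laurent L) d :
  (forall i, vle d (F i)) -> vle d (\sum_(i <- r) F i).
Proof. by move=> Fd; elim/big_ind: _ => // f g; apply: vleD. Qed.

Lemma lcoef_sum (I : Type) (r : seq I) (F : I -> laurent L) t :
  (\sum_(i <- r) F i) t = \sum_(i <- r) F i t.
Proof. by elim/big_rec2: _ => // i x y _ <-; rewrite Defs.coefD. Qed.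

Lemma coef_mono j a t : mono j a t = if t == j then a else 0. Proof. by []. Qed.

Lemma vle_mono d j a : j <= d -> vle d (mono j a).
Proof. by move=> jd t dt; rewrite coef_mono; case: eqP => // tj; lia. Qed.

Lemma vle_eq0 f : (forall d, vle d f) -> f = 0.
Proof. by move=> fd; apply: laurent_eqP => t; apply: (fd (t - 1)); lia. Qed.

Lemma mono0 j : mono j (0 : L) = 0.
Proof. by apply: laurent_eqP => t; rewrite coef_mono if_same. Qed.

Lemma mono_neq0 j a : a != 0 -> mono j a != 0.
Proof.
apply: contra_neq => /(congr1 (fun f : laurent L => f j)).
by rewrite coef_mono eqxx Defs.coef0.
Qed.

Lemma monoZ j a b : a *: mono j b = mono j (a * b).
Proof.
by apply: laurent_eqP => t; rewrite lcoefZ !coef_mono; case: ifP; rewrite ?mulr0.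
Qed.

Lemma vle_degP d f : vle d f <-> (deg f <= d%:E)%E.
Proof.
have [->|f0] := eqVneq f 0; first by rewrite deg0 leNye; split.
have [k [-> fk0 fk]] := degP f0; rewrite lee_fin; split=> [fd|kd t dt].
  by rewrite leNgt; apply: contra fk0 => /fd ->.
by apply: fk; apply: le_lt_trans dt.
Qed.

Lemma deg_eq f k : f k != 0 -> vle k f -> deg f = k%:E.
Proof.
move=> fk fv; have f0 : f != 0 by apply: contraNneq fk => ->.
have [l [-> fl0 fl]] := degP f0; congr (_%:E); apply/le_anti/andP; split.
  by rewrite leNgt; apply: contra fl0 => /fv ->.
by rewrite leNgt; apply: contra fk => /fl ->.
Qed.

(** * Summation of locally finite families *)

(** Unconditional convergence in algebraic form: up to terms of degree at most [d], every
    duplicate-free list containing [r] already sums to [s]. *)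
Definition hsum (I : eqType) (F : I -> laurent L) (s : laurent L) : Prop :=
  forall d, exists r : seq I, forall r', uniq r' -> {subset r <= r'} ->
    vle d (s - \sum_(i <- r') F i).

(** The value 0 is a default for families without a sum. *)
Definition lsum (I : eqType) (F : I -> laurent L) : laurent L :=
  xget 0 [set s | hsum F s].

(** Forcing a prescribed list [r] into the approximating one lets two sums, or a sum and a support,
    be compared on the same list. *)
Lemma hsum_at (I : eqType) (F : I -> laurent L) s d (r : seq I) : hsum F s ->
  exists r', [/\ uniq r', {subset r <= r'} & vle d (s - \sum_(i <- r') F i)].
Proof.
move=> /(_ d)[r0 hr0]; exists (undup (r0 ++ r)); split.
- exact: undup_uniq.
- by move=> i ir; rewrite mem_undup mem_cat ir orbT.
apply: hr0; first exact: undup_uniq.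
by move=> i ir; rewrite mem_undup mem_cat ir.
Qed.

Lemma hsum_coef (I : eqType) (F : I -> laurent L) s (r : seq I) t :
  hsum F s -> uniq r -> (forall i, i \notin r -> F i t = 0) ->
  s t = \sum_(i <- r) F i t.
Proof.
(* An error of degree at most [t - 1] leaves the coefficient of T^t exact. *)
move=> /(hsum_at (t - 1) r)[r' [ur' rr' /(_ t)]] H ur F0.
have /H/eqP : t - 1 < t by lia.
rewrite Defs.coefB subr_eq0 lcoef_sum => /eqP ->; apply: eq_big_supp => // i ir'.
by apply: F0; apply: contra ir' => /rr'.
Qed.

Lemma hsum_unique (I : eqType) (F : I -> laurent L) s s' :
  hsum F s -> hsum F s' -> s = s'.
Proof.
move=> hs hs'; apply/eqP; rewrite -subr_eq0; apply/eqP/vle_eq0 => d.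
have [r hr] := hs d; have [r' [ur' rr' hr']] := hsum_at d r hs'.
have -> : s - s' = (s - \sum_(i <- r') F i) - (s' - \sum_(i <- r') F i).
  by rewrite opprB addrA subrK.
by apply: vleB => //; apply: hr.
Qed.

Lemma eq_hsum (I : eqType) (F G : I -> laurent L) s :
  F =1 G -> hsum F s -> hsum G s.
Proof.
move=> FG hs d; have [r hr] := hs d; exists r => r' u rr'.
by rewrite -(eq_bigr _ (fun i _ => FG i)); apply: hr.
Qed.

Lemma hsum_vle (I : eqType) (F : I -> laurent L) s d :
  (forall i, vle d (F i)) -> hsum F s -> vle d s.
Proof.
move=> Fd /(hsum_at d [::])[r [_ _ hr]].
by rewrite -(subrK (\sum_(i <- r) F i) s); apply: vleD => //; apply: vle_sum.
Qed.

Lemma hsumD (I : eqType) (F G : I -> laurent L) s s' :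
  hsum F s -> hsum G s' -> hsum (fun i => F i + G i) (s + s').
Proof.
move=> hs hs' d; have [r hr] := hs d; have [r1 hr1] := hs' d.
exists (r ++ r1) => r' u rr'.
rewrite big_split /= opprD addrACA; apply: vleD; [apply: hr|apply: hr1] => // i.
  by move=> ir; apply: rr'; rewrite mem_cat ir.
by move=> ir; apply: rr'; rewrite mem_cat ir orbT.
Qed.

(** The common bound [e] makes the coefficientwise sum a Laurent series; the second clause makes
    each of its coefficients a finite sum. *)
Definition locally_finite (I : eqType) (F : I -> laurent L) : Prop :=
  (exists e, forall i, vle e (F i)) /\
  forall d, exists r : seq I, forall i, i \notin r -> vle d (F i).

Lemma lsumP (I : eqType) (F : I -> laurent L) :
  locally_finite F -> hsum F (lsum F).
Proof.
move=> [[e Fe] Ffin].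
suff [s hs] : exists s, hsum F s by apply: (@xgetPex _ 0 [set s | hsum F s]); exists s.
have /choice[r hr] : forall t, exists r : seq I,
    uniq r /\ forall i, i \notin r -> F i t = 0.
  move=> t; have [r hr] := Ffin (t - 1); exists (undup r).
  rewrite undup_uniq; split=> // i; rewrite mem_undup => /hr; apply; lia.
have sP : laurent_coef (fun t => \sum_(i <- r t) F i t).
  by apply/asboolP; exists e => t et; rewrite big1// => i _; apply: Fe.
exists (Laurent sP) => d; have [r0 hr0] := Ffin d.
exists r0 => r' ur' rr' t dt; rewrite Defs.coefB lcoef_sum /=.
have [ur hrt] := hr t; apply/eqP; rewrite subr_eq0; apply/eqP.
apply: eq_big_supp => // i ir'; apply: (hr0 i) => //.
by apply: contra ir' => /rr'.
Qed.

(** One list per degree is enough: the terms outside it do not reach above [d], so enlarging the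
    list changes no coefficient there. *)
Lemma hsum_from_truncation (I : eqType) (F : I -> laurent L) s :
  (forall d, exists r : seq I, [/\ uniq r, forall i, i \notin r -> vle d (F i) &
     vle d (s - \sum_(i <- r) F i)]) -> hsum F s.
Proof.
move=> H d; have [r [ur Fr sr]] := H d; exists r => r' ur' rr' t dt.
have /eqP := sr t dt; rewrite !Defs.coefB subr_eq0 => /eqP ->.
rewrite !lcoef_sum; apply/eqP; rewrite subr_eq0; apply/eqP/eq_big_supp => // i ir.
  exact: Fr.
by apply: (Fr i) => //; apply: contra ir => /rr'.
Qed.

Lemma hsum_from_coef (I : eqType) (F : I -> laurent L) (s : laurent L) :
  locally_finite F ->
  (forall t, exists r : seq I, [/\ uniq r, forall i, i \notin r -> F i t = 0 &
     s t = \sum_(i <- r) F i t]) -> hsum F s.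
Proof.
move=> /lsumP Fs H; suff -> : s = lsum F by [].
apply: laurent_eqP => t; have [r [ur Fr ->]] := H t.
by rewrite (hsum_coef Fs ur Fr).
Qed.

(** * Additive operators that raise degrees by a bounded amount *)

Definition bounded_op e (A : laurent L -> laurent L) : Prop :=
  {morph A : f g / f + g} /\ forall d f, vle d f -> vle (d + e) (A f).

Section BoundedOp.
Variables (e : int) (A : laurent L -> laurent L).
Hypothesis bA : bounded_op e A.

Lemma bopD f g : A (f + g) = A f + A g. Proof. exact: bA.1. Qed.
Lemma bop0 : A 0 = 0.
Proof. by apply: (addrI (A 0)); rewrite -bopD !addr0. Qed.
Lemma bopN f : A (- f) = - A f.
Proof. by apply/eqP; rewrite -addr_eq0 -bopD addNr bop0. Qed.
Lemma bopB f g : A (f - g) = A f - A g. Proof. by rewrite bopD bopN. Qed.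
Lemma bop_sum (I : Type) (r : seq I) (F : I -> laurent L) :
  A (\sum_(i <- r) F i) = \sum_(i <- r) A (F i).
Proof. exact: (big_morph A bopD bop0). Qed.

(** An error of degree at most d - e is sent to one of degree at most d, so these operators pass
    through infinite sums. *)
Lemma bop_hsum (I : eqType) (F : I -> laurent L) s :
  hsum F s -> hsum (A \o F) (A s).
Proof.
move=> hs d; have [r hr] := hs (d - e); exists r => r' u rr'.
by rewrite -bop_sum -bopB -(subrK e d); apply: bA.2; apply: hr.
Qed.
End BoundedOp.

Lemma bop_comp e e' A B : bounded_op e A -> bounded_op e' B ->
  bounded_op (e + e') (A \o B).
Proof.
move=> bA bB; split=> [f g|d f fd] /=; first by rewrite (bopD bB) (bopD bA).
by rewrite (addrC e) addrA; apply: bA.2; apply: bB.2.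
Qed.

Lemma bop_id : bounded_op 0 id.
Proof. by split=> // d f; rewrite addr0. Qed.

Lemma bop_scale a : bounded_op 0 (fun f => a *: f).
Proof. by split=> [f g|d f]; rewrite ?scalerDr// addr0; apply: vleZ. Qed.

(** * Series as sums of their monomials *)

Definition zrange d n : seq int := [seq d - (k : nat)%:Z | k <- iota 0 n].

Lemma zrange_uniq d n : uniq (zrange d n).
Proof. by rewrite map_inj_uniq ?iota_uniq// => x y; lia. Qed.

Lemma notin_zrange d n t : t \notin zrange d n -> t <= d - n%:Z \/ d < t.
Proof.
move=> H; have [dt|td] := ltP d t; [by right|left; rewrite leNgt].
apply: contra H => dnt; apply/mapP; exists `|d - t|%N; last by lia.
rewrite mem_iota; lia.
Qed.

Lemma vle_truncation d n f (r : seq int) :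
  vle d f -> uniq r -> {subset zrange d n <= r} ->
  vle (d - n%:Z) (f - \sum_(i <- r) mono i (f i)).
Proof.
move=> fd ur rr t dt; rewrite Defs.coefB lcoef_sum.
have [tr|tr] := boolP (t \in r).
  rewrite (bigD1_seq t)// coef_mono eqxx big1 => [|i it].
    by rewrite /= addr0 subrr.
  by rewrite coef_mono eq_sym (negPf it).
have -> : f t = 0.
  have /notin_zrange[] : t \notin zrange d n by apply: contra tr => /rr.
    by lia.
  exact: fd.
rewrite big_seq big1 ?subrr// => i ir; rewrite coef_mono; case: eqP => // ti.
by rewrite ti ir in tr.
Qed.

Lemma hsum_mono f : hsum (fun t => mono t (f t)) f.
Proof.
have [k fk] := laurentP f; move=> d; exists (zrange k `|k - d|%N) => r' u rr'.
by apply: vleW (vle_truncation fk u rr'); lia.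
Qed.

(** Every series is the sum of its monomials, and both operators preserve sums. *)
Lemma bop_ext e e' A B : bounded_op e A -> bounded_op e' B ->
  (forall i a, A (mono i a) = B (mono i a)) -> A =1 B.
Proof.
move=> bA bB AB f; apply: (@hsum_unique _ (fun t => A (mono t (f t)))).
  exact: (bop_hsum bA (hsum_mono f)).
by apply: (eq_hsum _ (bop_hsum bB (hsum_mono f))) => t /=.
Qed.

Lemma locally_finite_int (F : int -> laurent L) d e :
  (forall i, vle (d + i) (F i)) -> (forall i, e < i -> F i = 0) ->
  locally_finite F.
Proof.
move=> Fd Fe; split=> [|t].
  exists (d + e) => i; have [/Fe -> //|ie] := ltP e i.
  by apply: vleW (Fd i); lia.
exists (zrange e `|(e + d - t)%R|%N) => i /notin_zrange[ie|/Fe -> //].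
by apply: vleW (Fd i); lia.
Qed.

(** The shape of power series in an operator that lowers degrees: the coefficient of T^t only
    involves the terms with k <= d - t. *)
Definition graded d (F : nat -> laurent L) := forall k, vle (d - k%:Z) (F k).

Lemma graded_locally_finite d F : graded d F -> locally_finite F.
Proof.
move=> Fd; split=> [|e]; first by exists d => k; apply: vleW (Fd k); lia.
exists (iota 0 `|d - e|%N) => k; rewrite mem_iota => H.
by apply: vleW (Fd k); lia.
Qed.

Lemma gsumP d F : graded d F -> hsum F (lsum F).
Proof. by move=> /graded_locally_finite /lsumP. Qed.

Lemma gsumE d F t n : graded d F -> d - t < n%:Z ->
  lsum F t = \sum_(k < n) F k t.
Proof.
move=> Fd dn; rewrite (hsum_coef (r := iota 0 n) (gsumP Fd)) ?iota_uniq//.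
  by rewrite -(big_mkord xpredT (fun k => F k t)) /index_iota subn0.
by move=> k; rewrite mem_iota => H; apply: Fd; lia.
Qed.

Fact shift_subproof i f : laurent_coef (fun t => f (t - i)).
Proof.
by have [k fk] := laurentP f; apply/asboolP; exists (k + i) => t kt; apply: fk; lia.
Qed.
(** This will be right multiplication by T^i, which leaves coefficients unchanged. *)
Definition shift i f := Laurent (shift_subproof i f).

Arguments shift : simpl never.

Lemma coef_shift i f t : shift i f t = f (t - i). Proof. by []. Qed.

Lemma bop_shift i : bounded_op i (shift i).
Proof.
split=> [f g|d f fd t dt]; last by rewrite coef_shift; apply: fd; lia.
by apply: laurent_eqP.
Qed.

Lemma shift_mono i j a : shift i (mono j a) = mono (j + i) a.
Proof. by apply: laurent_eqP => t; rewrite coef_shift !coef_mono subr_eq. Qed.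

Lemma shiftZ i a f : shift i (a *: f) = a *: shift i f.
Proof. exact: laurent_eqP. Qed.

Lemma shift_add i j f : shift i (shift j f) = shift (i + j) f.
Proof. by apply: laurent_eqP => t; rewrite !coef_shift opprD addrA. Qed.

Lemma shift0 f : shift 0 f = f.
Proof. by apply: laurent_eqP => t; rewrite coef_shift subr0. Qed.

(** * The topology *)

Lemma nbhs_laurentP f (A : set (laurent L)) :
  nbhs f A <-> exists d, forall g, vle d (f - g) -> A g.
Proof.
split=> [/nbhs_ballP[e /= e0 fA]|[d fA]].
  (* An integer strictly below ln e, as the ball is open. *)
  exists (Num.floor (ln e) - 1) => g fg; apply: fA.
  rewrite ballEmdist /=; apply: le_lt_trans (exp_deg_le fg) _.
  rewrite -[ltRHS]lnK ?posrE// ltr_expR.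
  apply: lt_le_trans (floor_le_tmp _).
  by rewrite ltr_int ltrBlDr ltrDl.
(* The ball is open, so radius e^(d+1) forces degree at most d. *)
apply/nbhs_ballP; exists (expR ((d + 1)%:~R)); first exact: expR_gt0.
move=> g; rewrite ballEmdist /= => fg; apply: fA.
have [->|/degP[k [fgk _ fgv]]] := eqVneq (f - g) 0; first exact: vle0.
move: fg; rewrite /mdist /= /ldist /exp_deg fgk ltr_expR ltr_int => kd.
by apply: (@vleW k); [lia | exact: fgv].
Qed.

Lemma has_sum_hsum (I : choiceType) (F : I -> laurent L) s :
  hsum F s -> has_sum F s.
Proof.
move=> hs A /nbhs_laurentP[d dA]; have [r hr] := hs d.
have [X rX] : exists X : finmap.finset_of (Phant I), {subset r <= finmap.enum_fset X}.
  by exists (finmap.seq_fset tt r) => i; rewrite finmap.seq_fsetE.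
exists X => // B /= /finmap.fsubsetP XB; apply: dA.
rewrite /= /partial_sum -(finmap.big_seq_fsetE _ B xpredT F); apply: hr => [|i ir].
  exact: finmap.fset_uniq.
by apply/XB/rX.
Qed.

Lemma laurent_add_continuous :
  continuous (fun p : laurent L * laurent L => p.1 + p.2).
Proof.
move=> [f g] A /nbhs_laurentP[d dA].
exists ([set f' | vle d (f - f')], [set g' | vle d (g - g')]).
  by split; apply/nbhs_laurentP; exists d.
move=> [f' g'] [/= ff' gg']; apply: dA.
by rewrite /= opprD addrACA; apply: vleD.
Qed.

Lemma laurent_opp_continuous : continuous (fun f : laurent L => - f).
Proof.
move=> f A /nbhs_laurentP[d dA]; apply/nbhs_laurentP; exists d => g fg; apply: dA.
by rewrite -opprD; apply: vleN.
Qed.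

Lemma laurent_complete : complete_space (laurent L).
Proof.
move=> F PF /cauchyP Fc.
have /choice[c hc] : forall d, exists f, F [set g | vle d (f - g)].
  move=> d; have [f Ff] := Fc (expR ((d + 1)%:~R)) (expR_gt0 _).
  exists f; apply: filterS Ff => g; rewrite ballEmdist /=.
  have [->|/degP[k [fgk _ fgv]]] := eqVneq (f - g) 0; first by move=> _; exact: vle0.
  rewrite /mdist /= /ldist /exp_deg fgk ltr_expR ltr_int => kd.
  by apply: (@vleW k); [lia | exact: fgv].
have cc d e t : d < t -> e < t -> c d t = c e t.
  move=> dt et; have [g [/= dg eg]] := filter_ex (filterI (hc d) (hc e)).
  have /eqP := dg t dt; have /eqP := eg t et.
  by rewrite !Defs.coefB !subr_eq0 => /eqP -> /eqP ->.
(* The limit takes its coefficient of T^t from the approximation [c (t - 1)], exact in that degree;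
   for t > 0 it agrees with [c 0], which bounds the support above. *)
have lP : laurent_coef (fun t => c (t - 1) t).
  have [k ck] := laurentP (c 0); apply/asboolP; exists (Num.max k 0) => t.
  by rewrite gt_max => /andP[kt t0]; rewrite (cc _ 0)// ?ck//; lia.
exists (Laurent lP) => A /nbhs_laurentP[d dA]; apply: filterS (hc d) => g dg.
apply: dA => t dt; rewrite -(dg t dt) !Defs.coefB /=; congr (_ - _).
by apply: cc => //; lia.
Qed.

(** * Binomial coefficients with an integer upper argument *)

Section Binomial.
Hypothesis char0 : [pchar L] =i pred0.

Lemma natr_neq0 n : n.+1%:R != 0 :> L.
Proof. by rewrite ((pcharf0P _).1 char0). Qed.

Lemma intr_neq0 i : i != 0 -> i%:~R != 0 :> L.
Proof.
case: i => [[//|n]|n] _; first exact: natr_neq0.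
by rewrite NegzE mulrNz oppr_eq0 natr_neq0.
Qed.

Lemma binz0 i : binz L i 0 = 1.
Proof. by rewrite /binz big_ord0 fact0 divr1. Qed.

Lemma binz1 i : binz L i 1 = i%:~R.
Proof. by rewrite /binz big_ord_recr big_ord0 /= mul1r subr0 divr1. Qed.

Lemma binz_pascal i k : binz L (i + 1) k.+1 = binz L i k.+1 + binz L i k.
Proof.
have kf0 : k`!%:R != 0 :> L by case: k`! (fact_gt0 k) => // n _; apply: natr_neq0.
rewrite /binz factS natrM [in LHS]big_ord_recl [in RHS]big_ord_recr /=.
(* All terms are multiples of the product of the i - r for r < k; what remains is i + 1 = (i - k) +
   (k + 1). *)
under eq_bigr => r _.
  have -> : (i + 1)%:~R - (bump 0 r)%:R = i%:~R - r%:R :> L.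
    by rewrite rmorphD /= /bump add1n -addn1 natrD opprD addrACA subrr addr0.
  over.
set Q := \prod_(_ < k) _; rewrite rmorphD /= subr0.
have := natr_neq0 k; rewrite -addn1 natrD => k0; field.
by rewrite kf0 k0.
Qed.

Lemma binz_0S k : binz L 0 k.+1 = 0.
Proof. by rewrite /binz big_ord_recl /= subr0 !mul0r. Qed.

(** Pascal's rule, read in both directions from i = 0, carries integrality to negative i. *)
Lemma binz_int i k : exists z : int, binz L i k = z%:~R.
Proof.
elim: k i => [|k IH]; first by move=> i; exists 1; rewrite binz0.
apply: int_shift_ind => [|i]; first by exists 0; rewrite binz_0S.
have [y hy] := IH i; split=> -[z hz].
  by exists (z + y); rewrite binz_pascal hy hz rmorphD.
exists (z - y); rewrite rmorphB /= -hz -hy binz_pascal.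
by rewrite addrK.
Qed.

(** [A] is only additive, but it commutes with these scalars because they are integers. *)
Lemma bop_binz e A i k f : bounded_op e A ->
  A (binz L i k *: f) = binz L i k *: A f.
Proof.
move=> bA; have [z ->] := binz_int i k; rewrite !scaler_int.
have An n : A (f *+ n) = A f *+ n.
  by elim: n => [|n IH]; rewrite ?(bop0 bA)// !mulrSr (bopD bA) IH.
by case: z => n; rewrite ?NegzE /= ?mulrNz ?(bopN bA) -?pmulrn An.
Qed.
End Binomial.

(** * Powers of T *)

Section Powers.
Hypothesis char0 : [pchar L] =i pred0.
Variable delta : nat -> {additive L -> L}.

Fact dmap_subproof n f : laurent_coef (fun t => delta n (f (t + n.+1%:Z))).
Proof.
have [k fk] := laurentP f; apply/asboolP; exists k => t kt.
by rewrite fk ?raddf0//; lia.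
Qed.
(** Sends a T^j to [delta n a] T^(j-n-1): the index -n together with the extra factor T^-1. *)
Definition dmap n f := Laurent (dmap_subproof n f).
Arguments dmap : simpl never.

Lemma coef_dmap n f t : dmap n f t = delta n (f (t + n.+1%:Z)). Proof. by []. Qed.

Lemma bop_dmap n : bounded_op (- n.+1%:Z) (dmap n).
Proof.
split=> [f g|d f fd t dt]; last by rewrite coef_dmap fd ?raddf0//; lia.
by apply: laurent_eqP => t; rewrite Defs.coefD !coef_dmap Defs.coefD raddfD.
Qed.

(* [Nop] is T^-1 Delta, where Delta (\sum_j a_j T^j) is the sum of the
   delta_l(a_j) T^(j+l): left multiplication by T is T (1 + Nop). *)
Definition Nop f : laurent L := lsum (fun n => dmap n f).

Lemma graded_dmap d f : vle d f -> graded (d - 1) (fun n => dmap n f).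
Proof. by move=> fd n; apply: vleW ((bop_dmap n).2 _ _ fd); lia. Qed.

Lemma hsum_Nop f : hsum (fun n => dmap n f) (Nop f).
Proof. by have [d fd] := laurentP f; apply: gsumP (graded_dmap fd). Qed.

Lemma bop_Nop : bounded_op (-1) Nop.
Proof.
split=> [f g|d f fd].
  apply: (hsum_unique (hsum_Nop _)).
  apply: eq_hsum (hsumD (hsum_Nop f) (hsum_Nop g)) => n /=.
  by rewrite (bopD (bop_dmap n)).
apply: (hsum_vle _ (hsum_Nop f)) => n.
by apply: (@vleW (d - 1 - n%:Z)); [lia | apply: graded_dmap].
Qed.

Lemma Nop_coef d f t m : vle d f -> d - 1 - t < m%:Z ->
  Nop f t = \sum_(n < m) delta n (f (t + n.+1%:Z)).
Proof. by move=> fd dm; rewrite /Nop (gsumE (graded_dmap fd) dm). Qed.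

Lemma Nop_shift j f : Nop (shift j f) = shift j (Nop f).
Proof.
apply: (hsum_unique (hsum_Nop _)).
apply: eq_hsum (bop_hsum (bop_shift j) (hsum_Nop f)) => n /=.
by apply: laurent_eqP => t; rewrite coef_shift !coef_dmap coef_shift addrAC.
Qed.

Lemma bop_iterN k : bounded_op (- k%:Z) (iter k Nop).
Proof.
elim: k => [|k IH] /=; first by rewrite oppr0; apply: bop_id.
by rewrite intS opprD; apply: (bop_comp bop_Nop IH).
Qed.

Lemma iterN_shift k j f : iter k Nop (shift j f) = shift j (iter k Nop f).
Proof. by elim: k => //= k ->; rewrite Nop_shift. Qed.

(** The binomial series of (1 + [Nop])^i, which converges because the k-th iterate lowers degrees by
    k. *)
Definition Pow i f : laurent L := lsum (fun k => binz L i k *: iter k Nop f).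

Lemma graded_Pow i d f : vle d f ->
  graded d (fun k => binz L i k *: iter k Nop f).
Proof. by move=> fd k; apply: vleZ; apply: (bop_iterN k).2. Qed.

Lemma hsum_Pow i f : hsum (fun k => binz L i k *: iter k Nop f) (Pow i f).
Proof. by have [d fd] := laurentP f; apply: gsumP (graded_Pow i fd). Qed.

Lemma bop_Pow i : bounded_op 0 (Pow i).
Proof.
split=> [f g|d f fd].
  apply: (hsum_unique (hsum_Pow _ _)).
  apply: eq_hsum (hsumD (hsum_Pow i f) (hsum_Pow i g)) => k /=.
  by rewrite (bopD (bop_iterN k)) scalerDr.
rewrite addr0; apply: (hsum_vle _ (hsum_Pow i f)) => k.
by apply: (@vleW (d - k%:Z)); [lia | apply: graded_Pow].
Qed.

Lemma Pow_coef i d f t m : vle d f -> d - t < m%:Z ->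
  Pow i f t = \sum_(k < m) binz L i k * iter k Nop f t.
Proof.
by move=> fd dm; rewrite /Pow (gsumE (graded_Pow i fd) dm).
Qed.

Lemma Pow_shift i j f : Pow i (shift j f) = shift j (Pow i f).
Proof.
apply: (hsum_unique (hsum_Pow _ _)).
apply: eq_hsum (bop_hsum (bop_shift j) (hsum_Pow i f)) => k /=.
by rewrite shiftZ iterN_shift.
Qed.

Lemma Pow0 f : Pow 0 f = f.
Proof.
apply: laurent_eqP => t; have [d fd] := laurentP f.
rewrite (@Pow_coef _ d _ _ `|d - t|.+1)//; last by lia.
rewrite big_ord_recl binz0 mul1r big1 ?addr0// => k _.
by rewrite /= binz_0S mul0r.
Qed.

Lemma Nop_Pow i f : Nop (Pow i f) = Pow i (Nop f).
Proof.
symmetry; apply: (hsum_unique (hsum_Pow _ _)).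
apply: eq_hsum (bop_hsum bop_Nop (hsum_Pow i f)) => k /=.
by rewrite (bop_binz char0 _ _ _ bop_Nop) -iterS iterSr.
Qed.

Lemma PowS i f : Pow (i + 1) f = Pow i f + Nop (Pow i f).
Proof.
apply: laurent_eqP => t; have [d fd] := laurentP f.
rewrite Defs.coefD Nop_Pow.
(* [Nop f] has one degree less, so its expansion needs one term fewer; this matches the sums once
   the term k = 0 is split off. *)
have dt : d - t < `|d - t|.+1%:Z by lia.
have dt1 : d - 1 - t < `|d - t|%:Z by lia.
rewrite (Pow_coef (i + 1) fd dt) (Pow_coef i fd dt) (Pow_coef i (bop_Nop.2 _ _ fd) dt1).
rewrite [LHS]big_ord_recl [in RHS]big_ord_recl !binz0 -addrA; congr (_ + _).
rewrite -big_split /=; apply: eq_bigr => k _.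
by rewrite /bump add1n (binz_pascal char0) mulrDl -iterS iterSr.
Qed.

(* Left multiplication by T^i. *)
Definition Tmul i f : laurent L := shift i (Pow i f).

Lemma bop_Tmul i : bounded_op i (Tmul i).
Proof. by rewrite -[X in bounded_op X]addr0; apply: bop_comp (bop_shift i) (bop_Pow i). Qed.

Lemma Tmul_shift i j f : Tmul i (shift j f) = shift j (Tmul i f).
Proof. by rewrite /Tmul Pow_shift !shift_add addrC. Qed.

Lemma Tmul0 f : Tmul 0 f = f.
Proof. by rewrite /Tmul Pow0 shift0. Qed.

Lemma Pow1 f : Pow 1 f = f + Nop f.
Proof. by rewrite -[1 in LHS]add0r PowS Pow0. Qed.

Lemma TmulS i f : Tmul (i + 1) f = Tmul 1 (Tmul i f).
Proof.
rewrite {2}/Tmul Pow1 /Tmul -{1}[Pow (i + 1) f]/(Pow (i + 1) f) PowS.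
by rewrite Nop_shift -(bopD (bop_shift i)) shift_add (addrC 1).
Qed.

(** Only the term k = 0 of the binomial series reaches the top degree. Injectivity of [Tmul]
    follows. *)
Lemma Tmul_lead i d f : vle d f -> Tmul i f (d + i) = f d.
Proof.
move=> fd; rewrite /Tmul coef_shift addrK.
rewrite (@Pow_coef _ d _ _ 1)//; last by lia.
by rewrite big_ord_recl big_ord0 binz0 mul1r addr0.
Qed.

Lemma Tmul_eq0 i f : Tmul i f = 0 -> f = 0.
Proof.
move=> Tf; apply/eqP/negPn/negP => /degP[k [_ fk0 fk]].
by move: fk0; rewrite -(Tmul_lead i fk) Tf eqxx.
Qed.

Lemma Tmul_inj i : injective (Tmul i).
Proof.
move=> f g fg; apply/eqP; rewrite -subr_eq0; apply/eqP/(@Tmul_eq0 i).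
by rewrite (bopB (bop_Tmul i)) fg subrr.
Qed.

Lemma Tmul_add i j f : Tmul (i + j) f = Tmul i (Tmul j f).
Proof.
elim/int_shift_ind: i => [|i]; first by rewrite add0r Tmul0.
by rewrite addrAC !TmulS; split=> [->//|/Tmul_inj].
Qed.

(** Each of the k factors [Nop] picks some [delta n] and lowers the degree by n + 1; a total drop of
    k + s selects the compositions of s. *)
Lemma iterN_mono k s j b :
  iter k Nop (mono j b) (j - (k + s)%:Z) =
  \sum_(js <- compositions k s) delta_comp delta js b.
Proof.
elim: k s => [|k IH] s.
  rewrite -[iter _ _ _]/(mono j b) coef_mono; case: s => [|s] /=.
    by rewrite subr0 eqxx big_seq1.
  by rewrite big_nil; case: eqP => //; lia.
have vk : vle (j - k%:Z) (iter k Nop (mono j b)).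
  by apply: (bop_iterN k).2; apply: vle_mono.
rewrite iterS (Nop_coef (m := s.+1) vk); last by lia.
rewrite compositionsS big_allpairs_dep -(big_mkord xpredT (fun n => delta n
  (iter k Nop (mono j b) (j - (k.+1 + s)%:Z + n.+1%:Z)))) /index_iota subn0.
rewrite big_seq [RHS]big_seq; apply: eq_bigr => n; rewrite mem_iota => ns.
have -> : j - (k.+1 + s)%:Z + n.+1%:Z = j - (k + (s - n))%:Z by lia.
by rewrite IH raddf_sum.
Qed.

Lemma iterN_mono_eq0 k j b t : j - k%:Z < t -> iter k Nop (mono j b) t = 0.
Proof. by apply: (bop_iterN k).2; apply: vle_mono. Qed.

(** * The product *)

Definition Mul f g : laurent L := lsum (fun i : int => f i *: Tmul i g).

Lemma hsum_Mul f g : hsum (fun i : int => f i *: Tmul i g) (Mul f g).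
Proof.
have [d fd] := laurentP f; have [e ge] := laurentP g.
apply: lsumP; apply: (@locally_finite_int _ e d) => i.
  by apply: vleZ; apply: (bop_Tmul i).2.
by move=> /fd ->; rewrite scale0r.
Qed.

Lemma vle_Mul d e f g : vle d f -> vle e g -> vle (d + e) (Mul f g).
Proof.
move=> fd ge; apply: (hsum_vle _ (hsum_Mul f g)) => i.
have [/fd ->|id] := ltP d i; first by rewrite scale0r.
apply: vleZ; apply: (@vleW (e + i)); first by lia.
exact: (bop_Tmul i).2.
Qed.

Lemma bop_Mull e g : vle e g -> bounded_op e (Mul^~ g).
Proof.
move=> ge; split=> [f f'|d f fd]; last exact: vle_Mul.
apply: (hsum_unique (hsum_Mul _ _)).
apply: eq_hsum (hsumD (hsum_Mul f g) (hsum_Mul f' g)) => i /=.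
by rewrite -scalerDl.
Qed.

Lemma bop_Mulr d f : vle d f -> bounded_op d (Mul f).
Proof.
move=> fd; split=> [g g'|e g ge]; last by rewrite addrC; apply: vle_Mul.
apply: (hsum_unique (hsum_Mul _ _)).
apply: eq_hsum (hsumD (hsum_Mul f g) (hsum_Mul f g')) => i /=.
by rewrite (bopD (bop_Tmul i)) scalerDr.
Qed.

Lemma MulDl f f' g : Mul (f + f') g = Mul f g + Mul f' g.
Proof. by have [e ge] := laurentP g; rewrite (bopD (bop_Mull ge)). Qed.

Lemma MulDr f g g' : Mul f (g + g') = Mul f g + Mul f g'.
Proof. by have [d fd] := laurentP f; rewrite (bopD (bop_Mulr fd)). Qed.

Lemma Mul_mono i a g : Mul (mono i a) g = a *: Tmul i g.
Proof.
apply: laurent_eqP => t.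
rewrite (hsum_coef (r := [:: i]) (hsum_Mul _ _))// => [|k].
  by rewrite big_seq1 lcoefZ coef_mono eqxx.
by rewrite inE coef_mono => /negPf ->; rewrite scale0r.
Qed.

Lemma MulZl a f g : Mul (a *: f) g = a *: Mul f g.
Proof.
apply: (hsum_unique (hsum_Mul _ _)).
apply: eq_hsum (bop_hsum (bop_scale a) (hsum_Mul f g)) => i /=.
by rewrite scalerA.
Qed.

Lemma Mul_shiftr j f g : Mul f (shift j g) = shift j (Mul f g).
Proof.
apply: (hsum_unique (hsum_Mul _ _)).
apply: eq_hsum (bop_hsum (bop_shift j) (hsum_Mul f g)) => i /=.
by rewrite shiftZ Tmul_shift.
Qed.

(** Since [shift j f] stands for f T^j, this is associativity with a power of T in the middle; it
    rests on T^i T^j = T^(i+j) as operators. *)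
Lemma Mul_shiftl j f g : Mul (shift j f) g = Mul f (Tmul j g).
Proof.
have [e ge] := laurentP g.
have b1 := bop_comp (bop_Mull ge) (bop_shift j).
have b2 := bop_Mull ((bop_Tmul j).2 _ _ ge).
rewrite -[LHS]/((Mul^~ g \o shift j) f); apply: (bop_ext b1 b2) => i a /=.
by rewrite shift_mono !Mul_mono Tmul_add.
Qed.

(** The terms f_i T^i g with i < d have degree below d + e. *)
Lemma Mul_lead d e f g : vle d f -> vle e g -> Mul f g (d + e) = f d * g e.
Proof.
move=> fd ge; rewrite (hsum_coef (r := [:: d]) (hsum_Mul _ _))// => [|i].
  by rewrite big_seq1 lcoefZ addrC Tmul_lead.
rewrite inE => id; have [/fd ->|di] := ltP d i; first by rewrite scale0r.
apply: vleZ ((bop_Tmul i).2 _ _ ge) _ _; move/eqP: id; lia.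
Qed.

Lemma deg_Mul f g : deg (Mul f g) = (deg f + deg g)%E.
Proof.
have [->|f0] := eqVneq f 0.
  have [e ge] := laurentP g; rewrite (bop0 (bop_Mull ge)) deg0.
  by have [->|/degP[k [-> _ _]]] := eqVneq g 0; rewrite ?deg0.
have [->|g0] := eqVneq g 0.
  have [d fd] := laurentP f; rewrite (bop0 (bop_Mulr fd)) deg0.
  by have /degP[k [-> _ _]] := f0.
have [k [-> fk fv]] := degP f0; have [l [-> gl gv]] := degP g0.
by apply: deg_eq; [rewrite Mul_lead// mulf_neq0 | apply: vle_Mul].
Qed.

Lemma Mul_neq0 f g : f != 0 -> g != 0 -> Mul f g != 0.
Proof.
move=> /degP[k [_ fk fv]] /degP[l [_ gl gv]]; apply/eqP => fg.
by move/eqP: (Mul_lead fv gv); rewrite fg eq_sym mulf_eq0 (negPf fk) (negPf gl).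
Qed.

Lemma Nop_const a n : Nop (mono 0 a) (- n.+1%:Z) = delta n a.
Proof.
rewrite (Nop_coef (m := n.+1) (@vle_mono 0 0 a (lexx _))); last by lia.
rewrite big_ord_recr addNr big1 => [|k _]; first by rewrite /= add0r.
rewrite coef_mono; case: eqP => [|_]; last exact: raddf0.
by have := ltn_ord k; rewrite /=; lia.
Qed.

Lemma Tmul1_mono a :
  Tmul 1 (mono 0 a) = mono 1 a + nonpos_series (fun n => delta n a).
Proof.
apply: laurent_eqP => t; rewrite /Tmul Pow1 coef_shift !Defs.coefD !coef_mono subr_eq0.
congr (_ + _); rewrite [RHS]/=.
have vN : vle (0 - 1) (Nop (mono 0 a)) by apply: bop_Nop.2; apply: vle_mono.
case: ifP => t0; last by apply: vN; lia.
by have -> : t - 1 = - `|t|.+1%:Z; [lia | exact: Nop_const].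
Qed.

(** * The Leibniz rule and associativity *)

Definition Leibniz_op : Prop := forall b c,
  Mul (Tmul 1 (mono 0 b)) (mono 0 c) = Tmul 1 (mono 0 (b * c)).

Lemma nonpos_Mul_coef (u : nat -> L) c (n : nat) :
  Mul (nonpos_series u) (mono 0 c) (- n%:Z) =
  u n * c + \sum_(1 <= k < n.+1) \sum_(m < n.+1)
     \sum_(js : k.-tuple 'I_n.+1 | (\sum_(j <- js) (j : nat) + k + m == n)%N)
        binz L (- m%:Z) k * u m * delta_comp delta (map val js) c.
Proof.
rewrite (hsum_coef (r := zrange 0 n.+1) (hsum_Mul _ _)) ?zrange_uniq//; last first.
  move=> i /notin_zrange ir; have [/lt_geF i0|i0] := ltP 0 i.
    by rewrite lcoefZ /= i0 mul0r.
  apply: vleZ ((bop_Tmul i).2 _ _ (@vle_mono 0 0 c _)) _ _ => //.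
  by case: ir; lia.
rewrite big_map -[iota 0 n.+1]/(index_iota 0 n.+1) big_mkord.
(* The term k = 0 of the expansion of T^(-m) c contributes to T^(-n) only for m = n, that is
   [ord_max]. *)
have E (m : 'I_n.+1) :
   (nonpos_series u (0 - m%:Z) *: Tmul (0 - m%:Z) (mono 0 c)) (- n%:Z)
   = (if m == ord_max then u n * c else 0) + \sum_(1 <= k < n.+1)
     \sum_(js : k.-tuple 'I_n.+1 | (\sum_(j <- js) (j : nat) + k + m == n)%N)
        binz L (- m%:Z) k * u m * delta_comp delta (map val js) c.
  have mn : (m <= n)%N by rewrite -ltnS.
  rewrite lcoefZ sub0r.
  have -> : nonpos_series u (- m%:Z) = u m by rewrite /= oppr_le0 abszN.
  rewrite /Tmul coef_shift opprK (@Pow_coef _ 0 _ _ n.+1); first last.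
  - by lia.
  - exact: vle_mono.
  rewrite -(big_mkord xpredT (fun k => binz L (- m%:Z) k *
    iter k Nop (mono 0 c) (- n%:Z + m%:Z))) big_ltn// mulrDr mulr_sumr.
  congr (_ + _).
    rewrite binz0 mul1r -[iter _ _ _]/(mono 0 c) coef_mono.
    have -> : (- n%:Z + m%:Z == 0) = (m == ord_max) by rewrite -val_eqE /=; lia.
    by case: eqP => [->|]; rewrite ?mulr0.
  apply: eq_bigr => k _; rewrite -mulr_sumr sum_tuple_compositions mulrCA mulrA.
  congr (_ * _); case: ifP => km; last by apply: iterN_mono_eq0; lia.
  have -> : - n%:Z + m%:Z = 0 - (k + (n - m - k))%:Z by lia.
  exact: iterN_mono.
rewrite (eq_bigr _ (fun m _ => E m)) big_split /=; congr (_ + _).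
  by rewrite -big_mkcond big_pred1_eq.
by rewrite exchange_big.
Qed.

(** The terms bc T agree on both sides, and the coefficient of T^(-n) is the rule for [delta n]. *)
Lemma Leibniz_opP : Leibniz_op <-> delta_leibniz delta.
Proof.
have E b c : Mul (Tmul 1 (mono 0 b)) (mono 0 c) = mono 1 (b * c) +
    (b *: nonpos_series (fun n => delta n c) +
     Mul (nonpos_series (fun n => delta n b)) (mono 0 c)).
  by rewrite Tmul1_mono MulDl Mul_mono Tmul1_mono scalerDr monoZ addrA.
have coefn (u : nat -> L) n : nonpos_series u (- n%:Z) = u n.
  by rewrite /= oppr_le0 abszN.
have F b c n : (b *: nonpos_series (fun n => delta n c) +
     Mul (nonpos_series (fun n => delta n b)) (mono 0 c)) (- n%:Z) =
     b * delta n c + delta n b * c + \sum_(1 <= k < n.+1) \sum_(m < n.+1)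
     \sum_(js : k.-tuple 'I_n.+1 | (\sum_(j <- js) (j : nat) + k + m == n)%N)
        binz L (- m%:Z) k * delta m b * delta_comp delta (map val js) c.
  by rewrite Defs.coefD lcoefZ coefn nonpos_Mul_coef addrA.
split=> [H n a b|H b c].
  by rewrite -F -(coefn (fun n => delta n (a * b))); congr (lcoef _ _);
     apply: (addrI (mono 1 (a * b))); rewrite -E H Tmul1_mono.
rewrite E Tmul1_mono; congr (_ + _); apply: laurent_eqP => t.
have [t0|t0] := ltP 0 t; last first.
  by have -> : t = - `|t|%:Z by [lia]; rewrite F coefn H.
rewrite Defs.coefD lcoefZ /= lt_geF// mulr0 add0r.
have v0 (u : nat -> L) : vle 0 (nonpos_series u) by move=> x /lt_geF /= ->.
by apply: (vle_Mul (v0 _) (@vle_mono 0 0 c _)).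
Qed.

(* Both sides of an identity between additive bounded operators may be compared
   on monomials, and everything commutes with the right shifts, so associativity
   reduces to T (b c) = (T b) c for constants b, c. *)
Section Associativity.
Hypothesis leib : Leibniz_op.

Lemma Mul_Tmul1 g h : Mul (Tmul 1 g) h = Tmul 1 (Mul g h).
Proof.
have [e he] := laurentP h.
have b1 := bop_comp (bop_Mull he) (bop_Tmul 1).
have b2 := bop_comp (bop_Tmul 1) (bop_Mull he).
rewrite -[LHS]/((Mul^~ h \o Tmul 1) g) -[RHS]/((Tmul 1 \o Mul^~ h) g).
apply: (bop_ext b1 b2) => j b /=.
have -> : mono j b = shift j (mono 0 b) by rewrite shift_mono add0r.
rewrite Tmul_shift Mul_shiftl [in RHS]Mul_shiftl Mul_mono Tmul0.
have b3 := bop_Mulr ((bop_Tmul 1).2 _ _ (@vle_mono 0 0 b (lexx _))).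
have b4 := bop_comp (bop_Tmul 1) (bop_scale b).
(* With [Tmul j h] replaced by a free argument, both sides are bounded operators and are again
   compared on monomials. *)
suff /(_ (Tmul j h)) : Mul (Tmul 1 (mono 0 b)) =1 Tmul 1 \o (fun f => b *: f) by [].
apply: (bop_ext b3 b4) => l c /=.
have -> : mono l c = shift l (mono 0 c) by rewrite shift_mono add0r.
by rewrite -shiftZ Mul_shiftr Tmul_shift monoZ leib.
Qed.

Lemma Mul_Tmul i g h : Mul (Tmul i g) h = Tmul i (Mul g h).
Proof.
elim/int_shift_ind: i => [|i]; first by rewrite !Tmul0.
by rewrite !TmulS Mul_Tmul1; split=> [->//|/Tmul_inj].
Qed.

Lemma MulA : associative Mul.
Proof.
move=> f g h; have [e he] := laurentP h; have [d gd] := laurentP g.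
have b1 := bop_Mull (vle_Mul gd he).
have b2 := bop_comp (bop_Mull he) (bop_Mull gd).
rewrite -[RHS]/((Mul^~ h \o Mul^~ g) f); apply: (bop_ext b1 b2) => i a /=.
by rewrite !Mul_mono MulZl Mul_Tmul.
Qed.

Lemma Mul1l f : Mul (mono 0 1) f = f.
Proof. by rewrite Mul_mono Tmul0 scale1r. Qed.

(** By associativity (f 1 - f) 1 = 0, and the product has no zero divisors. *)
Lemma Mul1r f : Mul f (mono 0 1) = f.
Proof.
have n1 := mono_neq0 0 (oner_neq0 L).
apply/eqP; rewrite -subr_eq0; apply/negPn/negP => /Mul_neq0 /(_ n1).
have [d fd] := laurentP f.
by rewrite (bopB (bop_Mull (@vle_mono 0 0 1 (lexx _)))) -MulA Mul1l subrr eqxx.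
Qed.
End Associativity.

(** * Expansion of the product over monomials *)

Lemma hsum_Mul_mono f g :
  hsum (fun ij : int * int => Mul (mono ij.1 (f ij.1)) (mono ij.2 (g ij.2)))
       (Mul f g).
Proof.
have [k fk] := laurentP f; have [l gl] := laurentP g.
(* Keeping the top [n] exponents of each factor changes the product only in degrees at most k + l -
   n <= d. *)
apply: hsum_from_truncation => d; pose n := `|(k + l - d)%R|%N.
pose rf := zrange k n; pose rg := zrange l n.
exists [seq (i, j) | i <- rf, j <- rg]; split.
- by apply: allpairs_uniq; rewrite ?zrange_uniq// => -[? ?] [? ?].
- move=> [i j] /= ij.
  have [/fk ->|ik] := ltP k i.
    by rewrite mono0 (bop0 (bop_Mull (@vle_mono j j _ _))).
  have [/gl ->|jl] := ltP l j.
    by rewrite mono0 (bop0 (bop_Mulr (@vle_mono i i _ _))).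
  apply: (@vleW (i + j)); last by apply: vle_Mul; apply: vle_mono.
  have : (i \notin rf) || (j \notin rg).
    rewrite -negb_and; apply: contra ij => /andP[ir jr].
    by apply/allpairsP; exists (i, j).
  by case/orP => /notin_zrange; rewrite /n; lia.
rewrite big_allpairs; set f' := \sum_(i <- rf) mono i (f i).
set g' := \sum_(j <- rg) mono j (g j).
have ff' : vle (k - n%:Z) (f - f') by apply: vle_truncation; rewrite ?zrange_uniq.
have gg' : vle (l - n%:Z) (g - g') by apply: vle_truncation; rewrite ?zrange_uniq.
have f'k : vle k f' by rewrite -(subKr f f'); apply: vleB => //; apply: vleW ff'; lia.
have -> : \sum_(i <- rf) \sum_(j <- rg) Mul (mono i (f i)) (mono j (g j)) = Mul f' g'.
  have [e g'e] := laurentP g'; rewrite [in RHS]/f' (bop_sum (bop_Mull g'e)).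
  by apply: eq_bigr => i _; rewrite (bop_sum (bop_Mulr (@vle_mono i i _ _))).
have -> : Mul f g - Mul f' g' = Mul (f - f') g + Mul f' (g - g').
  rewrite (bopB (bop_Mull gl)) (bopB (bop_Mulr f'k)) addrA subrK//.
apply: vleD; [apply: vleW (vle_Mul ff' gl)|apply: vleW (vle_Mul f'k gg')]; rewrite /n; lia.
Qed.

Lemma sum_sub_seq (V : nmodType) (T : choiceType) (P : pred T) (r : seq T) (F : T -> V) :
  \sum_(x <- pmap (insub : T -> option {x | P x}) r) F (val x) =
  \sum_(x <- r | P x) F x.
Proof.
rewrite -(big_map val xpredT F) (pmap_filter (insubK _)) big_filter.
by apply: eq_bigl => x; rewrite isSome_insub.
Qed.

Lemma mem_pmap_insub (T : choiceType) (P : pred T) (r : seq T) (x : {x | P x}) :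
  (x \in pmap insub r) = (val x \in r).
Proof. by rewrite mem_pmap_sub. Qed.

Lemma hsum_mono_mul_term i j a b :
  hsum (fun js : {js : seq nat | js != [::]} =>
          mono_mul_term delta i j a b (val js))
       (Mul (mono i a) (mono j b) - mono (i + j) (a * b)).
Proof.
apply: hsum_from_coef => [|t].
  split=> [|d]; first by exists (i + j) => js; apply: vle_mono; lia.
  (* A term reaching above degree d has length plus sum below [N], hence both below [N]. *)
  pose N := `|(i + j - d)%R|%N.
  exists (pmap insub (flatten [seq [seq js | s <- iota 0 N, js <- compositions k s]
    | k <- iota 0 N])) => js; rewrite mem_pmap_insub => H.
  apply: vle_mono; rewrite leNgt; apply: contra H => H.
  have /andP[sN mN] : (size (val js) < N)%N && (sumn (val js) < N)%N.
    by rewrite /N; move: (sumn _) (size _) H => x y; lia.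
  apply/flatten_mapP; exists (size (val js)); first by rewrite mem_iota.
  apply/flatten_mapP; exists (sumn (val js)); first by rewrite mem_iota.
  by rewrite map_id mem_compositions !eqxx.
have [tij|tij] := ltP (i + j) t.
  exists [::]; split=> // [js _|]; first by apply: (@vle_mono (i + j)) => //; lia.
  rewrite big_nil Defs.coefB coef_mono; case: eqP => [|_]; first by lia.
  by rewrite subr0; apply: (@vle_Mul i j) => //; apply: vle_mono.
have [q tq] : exists q : nat, t = i + j - q%:Z by exists `|(i + j - t)%R|%N; lia.
(* The nonempty sequences contributing to T^(i+j-q), grouped by their length k >= 1. *)
pose r := [seq js | k <- iota 1 q, js <- compositions k (q - k)].
have mr js : (js \in r) = (js != [::]) && (sumn js + size js == q)%N.
  apply/allpairsPdep/andP => [[k [js' [kI]]]|[js0 /eqP jsq]].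
    rewrite mem_compositions => /andP[/eqP sz /eqP sm] ->.
    move: kI; rewrite mem_iota -size_eq0 sz sm; lia.
  have s0 : size js != 0%N by rewrite size_eq0.
  exists (size js), js; rewrite mem_iota mem_compositions eqxx /=; split=> //.
    by move: s0 jsq; move: (size js) (sumn js) => x y; lia.
  by apply/eqP; move: jsq; move: (size js) (sumn js) => x y; lia.
have ur : uniq r.
  apply: allpairs_uniq_dep => [|k _|]; [exact: iota_uniq|exact: compositions_uniq|].
  move=> _ _ /allpairsPdep[k [js [_ kjs ->]]] /allpairsPdep[k' [js' [_ kjs' ->]]] /= e.
  move: kjs kjs'; rewrite e !mem_compositions => /andP[/eqP <- _] /andP[/eqP <- _] //.
exists (pmap insub r); split; first exact: pmap_sub_uniq.
  move=> js; rewrite mem_pmap_insub mr (valP js) => H.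
  rewrite /mono_mul_term coef_mono; case: eqP => // e; move: H.
  rewrite tq in e; move: e; move: (sumn _) (size _) => x y e /eqP; lia.
rewrite (sum_sub_seq _ _ (fun js => mono_mul_term delta i j a b js t)).
rewrite -big_filter (_ : [seq _ <- r | _] = r); last first.
  by apply/all_filterP/allP => js; rewrite mr => /andP[].
rewrite big_allpairs_dep Defs.coefB Mul_mono lcoefZ /Tmul coef_shift.
have dq : j - (t - i) < q.+1%:Z by lia.
rewrite (Pow_coef i (@vle_mono j j b (lexx _)) dq).
rewrite -(big_mkord xpredT (fun k => binz L i k * iter k Nop (mono j b) (t - i))).
(* The term k = 0 is cancelled by the subtracted leading monomial, in accordance with the exclusion
   of the empty sequence. *)
rewrite big_ltn// mulrDr binz0 mul1r -[iter 0 _ _]/(mono j b) !coef_mono.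
have -> : (t - i == j) = (t == i + j) by lia.
rewrite [X in X + _ - _](_ : _ = if t == i + j then a * b else 0); last first.
  by case: ifP; rewrite ?mulr0.
rewrite addrAC subrr add0r mulr_sumr /index_iota subSS subn0.
rewrite big_seq [RHS]big_seq; apply: eq_bigr => k; rewrite mem_iota => kq.
have -> : t - i = j - (k + (q - k))%:Z by lia.
rewrite iterN_mono mulrCA mulrA mulr_sumr big_seq [RHS]big_seq.
apply: eq_bigr => js; rewrite mem_compositions => /andP[/eqP sz /eqP sm].
rewrite /mono_mul_term coef_mono sz sm; case: eqP => // H; exfalso; apply: H; lia.
Qed.

(** * Deformed Laurent series rings *)

Lemma mul_continuous_of_vle (mul : laurent L -> laurent L -> laurent L) :
  left_distributive mul +%R -> right_distributive mul +%R ->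
  (forall d e f g, vle d f -> vle e g -> vle (d + e) (mul f g)) ->
  continuous (fun p : laurent L * laurent L => mul p.1 p.2).
Proof.
move=> mulDl mulDr mulv [f g] A /nbhs_laurentP[d dA].
have [k fk] := laurentP f; have [l gl] := laurentP g.
(* The first two bounds bring (f - f') g and f' (g - g') down to degree d; the third keeps f' of
   degree at most k. *)
pose e := Num.min (d - l) (Num.min (d - k) k).
have [ek [el em]] : e + l <= d /\ k + e <= d /\ e <= k by rewrite /e; lia.
exists ([set f' | vle e (f - f')], [set g' | vle e (g - g')]).
  by split; apply/nbhs_laurentP; exists e.
move=> [f' g'] [/= ff' gg']; apply: dA => /=.
have f'k : vle k f'.
  by rewrite -(subKr f f'); apply: vleB => //; apply: vleW ff'.
have -> : mul f g - mul f' g' = mul (f - f') g + mul f' (g - g').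
  have mulBl x y z : mul (x - y) z = mul x z - mul y z.
    by apply/eqP; rewrite eq_sym subr_eq -mulDl subrK.
  have mulBr x y z : mul z (x - y) = mul z x - mul z y.
    by apply/eqP; rewrite eq_sym subr_eq -mulDr subrK.
  by rewrite mulBl mulBr addrA subrK.
by apply: vleD; [apply: vleW (mulv _ _ _ _ ff' gl)|apply: vleW (mulv _ _ _ _ f'k gg')].
Qed.

Lemma Mul_deformed : Leibniz_op -> deformed_laurent_ring Mul.
Proof.
move=> leib; split.
- exact: MulA.
- by move=> f f' g; rewrite MulDl.
- by move=> f g g'; rewrite MulDr.
- apply: mul_continuous_of_vle; [|..|exact: vle_Mul].
    by move=> f f' g; rewrite MulDl.
  by move=> f g g'; rewrite MulDr.
- by move=> b f; rewrite Mul_mono Tmul0.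
- move=> i j; have -> : mono j (1 : L) = shift j (mono 0 1) by rewrite shift_mono add0r.
  by rewrite Mul_shiftr (Mul1r leib) shift_mono.
- exact: deg_Mul.
Qed.

Lemma Mul_delta_rule : delta_rule delta Mul.
Proof. by move=> a; rewrite Mul_mono scale1r Tmul1_mono. Qed.

(** * Uniqueness of the multiplication *)

Section Uniqueness.
Variable mul : laurent L -> laurent L -> laurent L.
Hypotheses (defm : deformed_laurent_ring mul) (rule : delta_rule delta mul).

Let vle_mul d e f g : vle d f -> vle e g -> vle (d + e) (mul f g).
Proof.
rewrite !vle_degP (dl_deg defm) => fd ge.
by rewrite -[(d + e)%:E]/(d%:E + e%:E)%E; apply: leeD.
Qed.

Let bop_mull e g : vle e g -> bounded_op e (mul^~ g).
Proof.
by move=> ge; split=> [f f'|d f fd]; [rewrite (dl_mulDl defm) | apply: vle_mul].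
Qed.

Let bop_mulr d f : vle d f -> bounded_op d (mul f).
Proof.
move=> fd; split=> [g g'|e g ge]; first by rewrite (dl_mulDr defm).
by rewrite addrC; apply: vle_mul.
Qed.

Let mono_split i a : mono i a = mul (mono 0 a) (mono i 1).
Proof. by rewrite (dl_scale defm) monoZ mulr1. Qed.

Let mul_T j f : mul f (mono j 1) = shift j f.
Proof.
have b := bop_mull (@vle_mono j j 1 (lexx _)).
rewrite -[LHS]/((mul^~ (mono j 1)) f); apply: (bop_ext b (bop_shift j)) => i a.
by rewrite shift_mono (mono_split i a) -(dl_mulA defm) (dl_expT defm) -mono_split.
Qed.

(** By associativity T (a T^j) = (T a) T^j, and T a is prescribed by the rule. *)
Let mul_T1 g : mul (mono 1 1) g = Tmul 1 g.
Proof.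
have b := bop_mulr (@vle_mono 1 1 1 (lexx _)).
apply: (bop_ext b (bop_Tmul 1)) => j a.
have -> : mono j a = shift j (mono 0 a) by rewrite shift_mono add0r.
by rewrite Tmul_shift Tmul1_mono -rule -!mul_T (dl_mulA defm).
Qed.

Let mul_Tl i g : mul (mono i 1) g = Tmul i g.
Proof.
elim/int_shift_ind: i => [|i].
  by rewrite Tmul0 (dl_scale defm) scale1r.
rewrite addrC -(dl_expT defm) -(dl_mulA defm) mul_T1 addrC TmulS.
by split=> [->//|/Tmul_inj].
Qed.

Lemma deformed_mulE : mul = Mul.
Proof.
apply/funext => f; apply/funext => g; have [e ge] := laurentP g.
rewrite -[LHS]/((mul^~ g) f) -[RHS]/((Mul^~ g) f).
apply: (bop_ext (bop_mull ge) (bop_Mull ge)) => i a.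
by rewrite Mul_mono (mono_split i a) -(dl_mulA defm) mul_Tl (dl_scale defm).
Qed.

Lemma deformed_Leibniz : Leibniz_op.
Proof.
move=> b c; have := dl_mulA defm (mono 1 1) (mono 0 b) (mono 0 c).
by rewrite !mul_T1 (dl_scale defm) monoZ -deformed_mulE.
Qed.
End Uniqueness.

Lemma unique_mulP :
  (exists! mul, deformed_laurent_ring mul /\ delta_rule delta mul) <->
  delta_leibniz delta.
Proof.
rewrite -Leibniz_opP; split=> [[mul [[defm rule] _]]|leib].
  exact: deformed_Leibniz defm rule.
exists Mul; split; first by split; [exact: Mul_deformed | exact: Mul_delta_rule].
by move=> mul [defm rule]; rewrite (deformed_mulE defm rule).
Qed.

(** * Division and the center *)

Section DivisionRing.
Hypothesis leib : Leibniz_op.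

(** The inverse is the sum of the powers of h; multiplying it by h drops the first term. *)
Lemma geometric_inverse h : vle (-1) h ->
  exists x, Mul (mono 0 1 - h) x = mono 0 1.
Proof.
move=> h1; have bh := bop_Mulr h1.
pose pw k := iter k (Mul h) (mono 0 1).
have gpw : graded 0 pw.
  elim=> [|k IH]; first exact: vle_mono.
  by apply: vleW (vle_Mul h1 IH); lia.
have gpwS : graded 0 (fun k => pw k.+1) by move=> k; apply: vleW (gpw k.+1); lia.
have vx : vle 0 (lsum pw).
  apply: (hsum_vle _ (gsumP gpw)) => k; apply: (@vleW (0 - k%:Z)); first by lia.
  exact: gpw.
exists (lsum pw); rewrite (bopB (bop_Mull vx)).
rewrite Mul1l; have -> : Mul h (lsum pw) = lsum (fun k => pw k.+1).
  apply: (hsum_unique _ (gsumP gpwS)); exact: (bop_hsum bh (gsumP gpw)).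
apply: laurent_eqP => t; rewrite Defs.coefB.
have dt : 0 - t < `|t|.+1%:Z by lia.
have dt' : 0 - t < `|t|.+2%:Z by lia.
by rewrite (gsumE gpw dt') (gsumE gpwS dt) big_ord_recl /= addrK.
Qed.

Lemma Mul_right_inverse f : f <> 0 -> exists x, Mul f x = mono 0 1.
Proof.
(* The inverse of the leading coefficient normalizes f v to 1 plus terms of negative degree. *)
move=> /eqP /degP[k [_ fk fv]]; pose v := mono (- k) (f k)^-1.
have vv : vle (- k) v by apply: vle_mono.
have w0 : Mul f v 0 = 1.
  by rewrite -[0](subrr k) (Mul_lead fv vv) coef_mono eqxx mulfV.
have [x hx] : exists x, Mul (mono 0 1 - (mono 0 1 - Mul f v)) x = mono 0 1.
  apply: geometric_inverse => t t1; rewrite Defs.coefB coef_mono.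
  case: eqP => [->|/eqP t0]; first by rewrite w0 subrr.
  have fv0 := vle_Mul fv vv; rewrite subrr in fv0.
  by rewrite fv0 ?subr0//; lia.
by exists (Mul v x); rewrite MulA// -[RHS]hx subKr.
Qed.

Lemma one_neq0 : mono 0 1 <> 0 :> laurent L.
Proof. exact/eqP/mono_neq0/oner_neq0. Qed.

(** A right inverse x of f has itself a right inverse y, and f = f (x y) = (f x) y = y. *)
Lemma Mul_inverse f : f <> 0 ->
  exists x, Mul x f = mono 0 1 /\ Mul f x = mono 0 1.
Proof.
move=> f0; have [x fx] := Mul_right_inverse f0; exists x; split=> //.
have [y xy] : exists y, Mul x y = mono 0 1.
  apply: Mul_right_inverse => x0; apply: one_neq0.
  by have [d fd] := laurentP f; rewrite -fx x0 (bop0 (bop_Mulr fd)).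
have -> : f = y by rewrite -(Mul1r leib f) -xy MulA// fx Mul1l.
exact: xy.
Qed.

Lemma vle_inverse k f g : vle k f -> f k != 0 -> Mul f g = mono 0 1 -> vle (- k) g.
Proof.
move=> fv fk fg; have [->|/degP[l [_ gl gv]]] := eqVneq g 0; first exact: vle0.
suff : k + l = 0 by move=> kl; apply: vleW gv; lia.
apply/eqP; apply: contraNT (mulf_neq0 fk gl) => kl.
by rewrite -(Mul_lead fv gv) fg coef_mono (negPf kl).
Qed.

Lemma Mul_topological_division_ring : topological_division_ring Mul (mono 0 1).
Proof.
have defm := Mul_deformed leib.
have /choice[inv hinv] : forall f, exists x, f <> 0 ->
    Mul x f = mono 0 1 /\ Mul f x = mono 0 1.
  move=> f; have [f0|f0] := pselect (f = 0); first by exists 0.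
  by have [x hx] := Mul_inverse f0; exists x.
split.
- exact: laurent_add_continuous.
- exact: laurent_opp_continuous.
- exact: dl_mul_continuous defm.
- exact: dl_mulA defm.
- exact: dl_mulDl defm.
- exact: dl_mulDr defm.
- exact: Mul1l.
- exact: Mul1r.
- exact: one_neq0.
exists inv; first exact: hinv.
apply: continuous_in_subspaceT => f; rewrite inE /= => f0 A /nbhs_laurentP[d dA].
have /eqP/degP[k [_ fk fv]] := f0.
(* Agreement down to T^k preserves the leading term; an error of degree d + 2k becomes d after
   multiplication by two inverses of degree -k. *)
apply/nbhs_laurentP; exists (Num.min (k - 1) (d + k + k)) => g fg; apply: dA.
have ek : Num.min (k - 1) (d + k + k) < k by lia.
have gk : g k = f k.
  by have /eqP := fg k ek; rewrite Defs.coefB subr_eq0 => /eqP.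
have gv : vle k g by rewrite -(subKr f g); apply: vleB => //; apply: vleW fg; lia.
have g0 : g <> 0 by move=> g0; move: fk; rewrite -gk g0 eqxx.
have [fi1 fi2] := hinv f f0; have [gi1 gi2] := hinv g g0.
have iv : vle (- k) (inv f) by apply: vle_inverse fv fk fi2.
have jv : vle (- k) (inv g) by apply: vle_inverse gv _ gi2; rewrite gk.
(* The resolvent identity turns closeness of f and g into closeness of their inverses. *)
have -> : inv f - inv g = Mul (Mul (inv f) (g - f)) (inv g).
  rewrite (bopB (bop_Mulr iv)) fi1 (bopB (bop_Mull jv)) -MulA// gi2 Mul1l.
  by rewrite Mul1r.
have gf : vle (Num.min (k - 1) (d + k + k)) (g - f) by rewrite -(opprB f g); apply: vleN.
by apply: vleW (vle_Mul (vle_Mul iv gf) jv); lia.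
Qed.

(** The difference T a - a T is the series with coefficients [delta n a]. *)
Lemma delta_kerP a :
  reflect (Mul (mono 1 1) (mono 0 a) = Mul (mono 0 a) (mono 1 1)) (a \in delta_ker delta).
Proof.
rewrite (Mul_mono 1) scale1r Tmul1_mono Mul_mono Tmul0 monoZ mulr1.
apply: (iffP (asboolP _)) => [d0|/eqP]; last first.
  rewrite eq_sym addrC -subr_eq subrr => /eqP/esym d0 n.
  have := congr1 (fun f : laurent L => f (- n%:Z)) d0.
  by rewrite /= oppr_le0 abszN.
rewrite [X in _ + X](_ : _ = 0) ?addr0//; apply: laurent_eqP => t /=.
by case: ifP => // _; apply: d0.
Qed.

Lemma Mul_const a b : Mul (mono 0 a) (mono 0 b) = mono 0 (a * b).
Proof. by rewrite Mul_mono Tmul0 monoZ. Qed.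

Lemma delta_ker_divring : GRing.divring_closed (delta_ker delta).
Proof.
split=> [|a b|a b].
- by apply/delta_kerP; rewrite Mul1l Mul1r.
- move=> /asboolP a0 /asboolP b0; apply/asboolP => n.
  by rewrite raddfB a0 b0 subr0.
move=> /delta_kerP Ta /delta_kerP Tb.
have [->|b0] := eqVneq b 0.
  by rewrite invr0 mulr0; apply/asboolP => n; rewrite raddf0.
(* If b commutes with T, then T b^-1 = b^-1 (b T) b^-1 = b^-1 T. *)
have Tb' : Mul (mono 1 1) (mono 0 b^-1) = Mul (mono 0 b^-1) (mono 1 1).
  have bb : mono 0 1 = Mul (mono 0 b^-1) (mono 0 b) by rewrite Mul_const mulVf.
  rewrite -[LHS]Mul1l bb -(MulA leib (mono 0 b^-1)).
  by rewrite (MulA leib (mono 0 b)) -Tb -(MulA leib (mono 1 1)) Mul_const (mulfV b0) (Mul1r leib).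
by apply/delta_kerP; rewrite -Mul_const (MulA leib (mono 1 1)) Ta
  -(MulA leib (mono 0 a)) Tb' (MulA leib).
Qed.

Lemma Tmul_delta_ker i a : a \in delta_ker delta -> Tmul i (mono 0 a) = mono i a.
Proof.
move=> /delta_kerP; rewrite !Mul_mono Tmul0 scale1r monoZ mulr1 => Ta.
have -> : mono i a = shift i (mono 0 a) by rewrite shift_mono add0r.
elim/int_shift_ind: i => [|i]; first by rewrite Tmul0 shift0.
have -> : shift (i + 1) (mono 0 a) = Tmul 1 (shift i (mono 0 a)).
  by rewrite Tmul_shift Ta !shift_mono add0r addrC.
by rewrite TmulS; split=> [->//|/Tmul_inj].
Qed.

(** * Commutation with constants when [delta m] is the first nonzero map *)

Section Center.
Variable m : nat.
Hypothesis delta_lt : forall n a, (n < m)%N -> delta n a = 0.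

Lemma vle_Nop_min d f : vle d f -> vle (d - m.+1%:Z) (Nop f).
Proof.
move=> fd; apply: (hsum_vle _ (hsum_Nop f)) => n.
have [nm|mn] := ltnP n m; first by move=> t _; rewrite coef_dmap delta_lt.
by apply: vleW ((bop_dmap n).2 _ _ fd); lia.
Qed.

Lemma vle_iterN_min k d f : vle d f -> vle (d - (k * m.+1)%:Z) (iter k Nop f).
Proof.
move=> fd; elim: k => [|k IH]; first by rewrite mul0n subr0.
by rewrite iterS; apply: vleW (vle_Nop_min IH); lia.
Qed.

(** In T^i a - a T^i the term k = 0 cancels, and the terms with k >= 2 lower the degree by at least
    2(m+1), so only k = 1 is left. *)
Lemma Tmul_const_coef i a t : i - m.+1%:Z <= t ->
  (Tmul i (mono 0 a) - mono i a) t = i%:~R * Nop (mono 0 a) (t - i).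
Proof.
move=> it; have [q tq] : exists q : nat, 0 - (t - i) < q.+2%:Z.
  by exists `|t - i|%N; lia.
rewrite Defs.coefB /Tmul coef_shift (Pow_coef i (@vle_mono 0 0 a (lexx _)) tq).
rewrite -(big_mkord xpredT (fun k => binz L i k * iter k Nop (mono 0 a) (t - i))).
rewrite big_ltn// big_ltn// big_nat big1 => [|k /andP[k2 _]].
  rewrite binz0 mul1r binz1 -[iter 0 _ _]/(mono 0 a) -[iter 1 _ _]/(Nop _).
  by rewrite !coef_mono subr_eq0 addr0 addrAC subrr add0r.
rewrite (vle_iterN_min (k := k) (@vle_mono 0 0 a (lexx _))) ?mulr0//.
have : (2 * m.+1 <= k * m.+1)%N by rewrite leq_mul2r k2 orbT.
by lia.
Qed.

(* If z has degree k and leading coefficient c, then the coefficient of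
   T^(k-1-m) in z a - a z is c k delta_m(a), which is nonzero for a suitable a
   unless k = 0. *)
Lemma centralizer_deg k z : (exists a, delta m a <> 0) ->
  vle k z -> z k != 0 -> (forall a, Mul z (mono 0 a) = Mul (mono 0 a) z) -> k = 0.
Proof.
move=> [a /eqP ma] zv zk /(_ a).
rewrite (Mul_mono 0) Tmul0 => comm.
(* The expansion of z a - a z along the powers of T in z. *)
have hs : hsum (fun i => z i *: (Tmul i (mono 0 a) - mono i a)) 0.
  have -> : 0 = Mul z (mono 0 a) + (- a) *: z by rewrite comm scaleNr subrr.
  apply: eq_hsum (hsumD (hsum_Mul z (mono 0 a))
    (bop_hsum (bop_scale (- a)) (hsum_mono z))) => i /=.
  by rewrite scalerBr scaleNr !monoZ mulrC.
(* For i < k, the series T^i a - a T^i has degree at most i-1-m and misses the exponent k-1-m. *)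
have zero i : i \notin [:: k] ->
    (z i *: (Tmul i (mono 0 a) - mono i a)) (k - m.+1%:Z) = 0.
  rewrite inE => ik; have [/zv ->|ki] := ltP k i; first by rewrite scale0r.
  rewrite lcoefZ Tmul_const_coef; last by lia.
  rewrite (vle_Nop_min (@vle_mono 0 0 a (lexx _))) ?mulr0//.
  by move/eqP: ik; lia.
have := hsum_coef (r := [:: k]) hs isT zero; rewrite big_seq1 lcoefZ Tmul_const_coef//.
rewrite addrAC subrr add0r Nop_const => /esym/eqP.
rewrite !mulf_eq0 (negPf zk) (negPf ma) orbF /=; apply: contraTeq.
exact: intr_neq0.
Qed.
End Center.

Lemma Mul_center : (exists n a, delta n a <> 0) ->
  ring_center Mul = [set mono 0 a | a in delta_ker delta].
Proof.
move=> dn0.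
have ex : exists n, `[< exists a, delta n a <> 0 >].
  by have [n dn] := dn0; exists n; apply/asboolP.
case: (ex_minnP ex) => m /asboolP dm mmin.
have delta_lt n a : (n < m)%N -> delta n a = 0.
  move=> nm; apply: contrapT => dna.
  by have := mmin n; rewrite leqNgt nm => /(_ (asboolT (ex_intro _ a dna))).
apply/seteqP; split=> [z zc|_ [a aK <-] x].
  (* A nonzero y commuting with the constants has degree 0, hence a nonzero coefficient at T^0. *)
  have comm (y : laurent L) : (forall b, Mul y (mono 0 b) = Mul (mono 0 b) y) ->
      y != 0 -> vle 0 y /\ y 0 != 0.
    move=> yc /degP[k [_ yk yv]].
    by have k0 := centralizer_deg delta_lt dm yv yk yc; rewrite k0 in yv yk.
  (* This difference still commutes with the constants, but its coefficient at T^0 is 0. *)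
  pose y := z - mono 0 (z 0).
  suff y0 : y = 0.
    have zE : z = mono 0 (z 0) by apply/eqP; rewrite -subr_eq0 -/y y0.
    exists (z 0); last by rewrite -zE.
    by apply/delta_kerP; rewrite -zE zc.
  apply/eqP/negPn/negP => /comm[b|_].
    rewrite (bopB (bop_Mull (@vle_mono 0 0 b (lexx _)))) zc Mul_const mulrC -Mul_const.
    by rewrite (bopB (bop_Mulr (@vle_mono 0 0 b (lexx _)))).
  by rewrite /y Defs.coefB coef_mono eqxx subrr eqxx.
have b1 := bop_Mulr (@vle_mono 0 0 a (lexx _)).
have b2 := bop_Mull (@vle_mono 0 0 a (lexx _)).
rewrite -[RHS]/((Mul^~ (mono 0 a)) x); apply: (bop_ext b1 b2) => i b.
by rewrite !Mul_mono Tmul0 Tmul_delta_ker// !monoZ mulrC.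
Qed.
End DivisionRing.
End Powers.
End Laurent.

Theorem theorem3p10 (L : fieldType) (char0 : [pchar L] =i pred0)
    (delta : nat -> {additive L -> L})
    (delta_neq0 : exists n a, delta n a <> 0) :
  let unique_mul := exists! mul : laurent L -> laurent L -> laurent L,
        deformed_laurent_ring mul /\ delta_rule delta mul in
  (unique_mul <-> delta_leibniz delta) /\
  (unique_mul \/ delta_leibniz delta ->
   forall mul : laurent L -> laurent L -> laurent L,
     deformed_laurent_ring mul -> delta_rule delta mul ->
     [/\ forall f g : laurent L,
           has_sum (fun ij : int * int =>
                      mul (mono ij.1 (f ij.1)) (mono ij.2 (g ij.2)))
                   (mul f g),
         forall (i j : int) (a b : L),
           exists2 s : laurent L,
             has_sum (fun js : {js : seq nat | js != [::]} =>
                        mono_mul_term delta i j a b (val js)) s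
             & mul (mono i a) (mono j b) = mono (i + j) (a * b) + s,
         topological_division_ring mul (mono 0 1),
         complete_space (laurent L)
         & GRing.divring_closed (delta_ker delta) /\
           ring_center mul = [set mono 0 a | a in delta_ker delta]]).
Proof.
split; first exact: unique_mulP.
move=> _ mul defm rule; have leib := deformed_Leibniz char0 defm rule.
rewrite (deformed_mulE char0 defm rule); split.
- by move=> f g; apply: has_sum_hsum; apply: hsum_Mul_mono.
- move=> i j a b; exists (Mul delta (mono i a) (mono j b) - mono (i + j) (a * b)).
    by apply: has_sum_hsum; apply: hsum_mono_mul_term.
  by rewrite addrC subrK.
- exact: Mul_topological_division_ring.
- exact: laurent_complete.
by split; [exact: delta_ker_divring | exact: Mul_center].
Qed.
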